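(* Let $R$ be a Quasi-Frobenius ring of finite representation type. Then the functor $$\Theta:\mathcal{S}(R\text{-}\mathrm{Mod})\longrightarrow((R\text{-}\underline{\mathrm{mod}})^{\mathrm{op}},\mathcal{A}b),\qquad \Theta(X\xrightarrow{f}Y)=i_\lambda\big(\mathrm{Cok}((-,X)\xrightarrow{(-,f)}(-,Y))\big),$$ is full, dense and objective.
   Context: A ring is Quasi-Frobenius (QF) if it is left and right artinian and left and right self-injective. $R$-module means left $R$-module. $R\text{-}\mathrm{Mod}$ is the category of all $R$-modules, $R\text{-}\mathrm{mod}$ the subcategory of finitely presented ones, $R\text{-}\underline{\mathrm{mod}}$ its stable category modulo projectives. $((R\text{-}\mathrm{mod})^{\mathrm{op}},\mathcal{A}b)$ is the category of additive contravariant functors $R\text{-}\mathrm{mod}\to\mathcal{A}b$ (abelian groups); $((R\text{-}\underline{\mathrm{mod}})^{\mathrm{op}},\mathcal{A}b)$ is identified with its full subcategory of functors vanishing on projective modules, with inclusion functor $i$. $(-,M)$ denotes $\mathrm{Hom}_R(-,M)$ restricted to $R\text{-}\mathrm{mod}$. The morphism category $\mathcal{H}(R\text{-}\mathrm{Mod})$ has as objects the morphisms of $R\text{-}\mathrm{Mod}$ and as morphisms the commutative squares; $\mathcal{S}(R\text{-}\mathrm{Mod})$ is its full subcategory of all monomorphisms. $i_\lambda:((R\text{-}\mathrm{mod})^{\mathrm{op}},\mathcal{A}b)\to((R\text{-}\underline{\mathrm{mod}})^{\mathrm{op}},\mathcal{A}b)$ is the left adjoint of the inclusion $i$. $\Theta$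 is the composite of the inclusion $\mathcal{S}(R\text{-}\mathrm{Mod})\hookrightarrow\mathcal{H}(R\text{-}\mathrm{Mod})$, the functor $\Sigma:(X\xrightarrow{f}Y)\mapsto\mathrm{Cok}(-,f)$, and $i_\lambda$. Explicitly, on objects: given a monomorphism $f:X\to Y$ with cokernel $g:Y\to Z$, choose an epimorphism $d:P\to Z$ with $P$ projective and $d_1:P\to Y$ with $gd_1=d$; then $\Theta(f)$ is the cokernel of $(-,P\oplus X)\to(-,Y)$ induced by $[d_1\ f]:P\oplus X\to Y$ (independent of choices). An additive functor $F:\mathcal{X}\to\mathcal{Y}$ between additive categories is objective if every morphism $h$ of $\mathcal{X}$ with $F(h)=0$ factors through an object $K$ with $F(K)=0$. Dense means essentially surjective on objects. *)

(* Defs.v *)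
From HB Require Import structures.
From mathcomp Require Import all_boot all_order all_algebra.
From mathcomp Require Import boolp.

Set Implicit Arguments.
Unset Strict Implicit.
Unset Printing Implicit Defensive.

Import GRing.Theory.
Local Open Scope ring_scope.
Local Open Scope quotient_scope.

Section Modules.
Variable R : pzRingType.
Implicit Types M N A B P E : lmodType R.

Definition module_iso M N : Prop := exists f : {linear M -> N}, bijective f.

Definition module_zero M : Prop := forall x : M, x = 0.

Definition projective_module P : Prop :=
  forall A B (f : {linear A -> B}) (g : {linear P -> B}),
    (forall b, exists a, f a = b) ->
    exists h : {linear P -> A}, forall x, f (h x) = g x.

Definition injective_module E : Prop :=
  forall A B (f : {linear A -> B}) (g : {linear A -> E}),
    injective f -> exists h : {linear B -> E}, forall x, h (f x) = g x.

Definition finitely_presented M : Prop :=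
  exists (m n : nat) (d : {linear 'rV[R]_m -> 'rV[R]_n})
         (e : {linear 'rV[R]_n -> M}),
    (forall x, exists v, e v = x) /\
    (forall v, e v = 0 <-> exists w, d w = v).

Definition indecomposable M : Prop :=
  ~ module_zero M /\
  forall A B, module_iso M (A * B)%type -> module_zero A \/ module_zero B.

(* Boolean predicates and arbitrary subsets coincide classically. *)
Definition artinian_module M : Prop :=
  forall S : nat -> {pred M},
    (forall n, GRing.submod_closed (S n)) ->
    (forall n, {subset S n.+1 <= S n}) ->
    exists n, forall m, (n <= m)%N -> S m =i S n.

End Modules.

(* Right R-modules are the left modules over the converse ring R^c. *)
Definition quasi_Frobenius (R : pzRingType) : Prop :=
  [/\ artinian_module (R^o : lmodType R),
      artinian_module ((R^c)^o : lmodType R^c),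
      injective_module (R^o : lmodType R)
    & injective_module ((R^c)^o : lmodType R^c)].

Definition finite_representation_type (R : pzRingType) : Prop :=
  exists (n : nat) (M_ : 'I_n -> lmodType R),
    forall M : lmodType R, finitely_presented M -> indecomposable M ->
      exists i, module_iso M (M_ i).

(* The group structure of the hom sets is not a zmodType: the natural
   transformations between functors on R-mod form a large type, whereas all
   carriers of zmodType's lie in one universe. *)
Record precat := Precat {
  obj :> Type;
  hom : obj -> obj -> Type;
  idm : forall x, hom x x;
  compm : forall x y z, hom y z -> hom x y -> hom x z;
  hom0 : forall x y, hom x y;
  homN : forall x y, hom x y -> hom x y;
  homD : forall x y, hom x y -> hom x y -> hom x y;
  comp1m : forall x y (f : hom x y), compm (idm y) f = f;
  compm1 : forall x y (f : hom x y), compm f (idm x) = f;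
  compmA : forall x y z t (h : hom z t) (g : hom y z) (f : hom x y),
    compm h (compm g f) = compm (compm h g) f;
  homDA : forall x y, associative (@homD x y);
  homDC : forall x y, commutative (@homD x y);
  hom0D : forall x y, left_id (hom0 x y) (@homD x y);
  homND : forall x y, left_inverse (hom0 x y) (@homN x y) (@homD x y);
  compmDl : forall x y z (g g' : hom y z) (f : hom x y),
    compm (homD g g') f = homD (compm g f) (compm g' f);
  compmDr : forall x y z (g : hom y z) (f f' : hom x y),
    compm g (homD f f') = homD (compm g f) (compm g f')
}.

Arguments hom {p} x y.
Arguments idm {p} x.
Arguments compm {p x y z} g f.
Arguments hom0 {p} x y.
Arguments homN {p x y} f.
Arguments homD {p x y} f g.

Declare Scope precat_scope.
Delimit Scope precat_scope with cat.
Local Open Scope precat_scope.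
Notation "g \co f" := (compm g f) (at level 40, left associativity) : precat_scope.

Record functor (A B : precat) := Functor {
  fob :> A -> B;
  fmor : forall x y : A, hom x y -> hom (fob x) (fob y);
  fmor1 : forall x, fmor (idm x) = idm (fob x);
  fmor_comp : forall x y z (g : hom y z) (f : hom x y),
    fmor (g \co f) = fmor g \co fmor f;
  fmorD : forall x y (f g : hom x y), fmor (homD f g) = homD (fmor f) (fmor g)
}.

Arguments fmor {A B} F {x y} f : rename.

Section Functors.
Variables A B C : precat.

Definition functor_id : functor A A.
Proof. by exists id (fun _ _ f => f). Defined.

Definition functor_comp (G : functor B C) (F : functor A B) : functor A C.
Proof.
exists (fun x => G (F x)) (fun x y f => fmor G (fmor F f)).
- by move=> x; rewrite !fmor1.
- by move=> x y z g f; rewrite !fmor_comp.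
- by move=> x y f g; rewrite !fmorD.
Defined.

Record nattrans (F G : functor A B) := Nattrans {
  ntapp :> forall x, hom (F x) (G x);
  ntP : forall x y (f : hom x y), ntapp y \co fmor F f = fmor G f \co ntapp x
}.

Lemma nattrans_ext F G (a b : nattrans F G) : (forall x, a x = b x) -> a = b.
Proof.
case: a b => [a aP] [b bP] /= eqab.
have eab : a = b by apply: functional_extensionality_dep.
by case: _ / eab bP {eqab} => bP; congr Nattrans; apply: Prop_irrelevance.
Qed.

End Functors.

Section HomTheory.
Variable C : precat.
Implicit Types x y z : C.

Lemma homD0 x y (f : hom x y) : homD f (hom0 x y) = f.
Proof. by rewrite homDC hom0D. Qed.

Lemma homDI x y (f g h : hom x y) : homD f g = homD f h -> g = h.
Proof.
by move=> e; rewrite -[g]hom0D -[h]hom0D -(homND f) -!homDA e.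
Qed.

Lemma comp0m x y z (f : hom x y) : hom0 y z \co f = hom0 x z.
Proof.
by apply: (@homDI _ _ (hom0 y z \co f)); rewrite -compmDl hom0D homD0.
Qed.

Lemma compm0 x y z (g : hom y z) : g \co hom0 x y = hom0 x z.
Proof.
by apply: (@homDI _ _ (g \co hom0 x y)); rewrite -compmDr hom0D homD0.
Qed.

Lemma compmN x y z (g : hom y z) (f : hom x y) : g \co homN f = homN (g \co f).
Proof.
by apply: (@homDI _ _ (g \co f)); rewrite -compmDr ![homD _ (homN _)]homDC
  !homND compm0.
Qed.

Lemma compNm x y z (g : hom y z) (f : hom x y) : homN g \co f = homN (g \co f).
Proof.
by apply: (@homDI _ _ (g \co f)); rewrite -compmDl ![homD _ (homN _)]homDC
  !homND comp0m.
Qed.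

End HomTheory.

Lemma fmor0 (A B : precat) (F : functor A B) x y :
  fmor F (hom0 x y) = hom0 (F x) (F y).
Proof.
by apply: (@homDI _ _ _ (fmor F (hom0 x y))); rewrite -fmorD hom0D homD0.
Qed.

Definition functor_cat (A B : precat) : precat.
Proof.
unshelve refine (@Precat (functor A B) (@nattrans A B) _ _ _ _ _
  _ _ _ _ _ _ _ _ _).
- by move=> F; exists (fun x => idm (F x)) => x y f; rewrite comp1m compm1.
- move=> F G H b a; exists (fun x => b x \co a x) => x y f.
  by rewrite -compmA ntP compmA ntP compmA.
- by move=> F G; exists (fun x => hom0 (F x) (G x)) => x y f; rewrite comp0m compm0.
- move=> F G a; exists (fun x => homN (a x)) => x y f.
  by rewrite compNm compmN ntP.
- move=> F G a b; exists (fun x => homD (a x) (b x)) => x y f.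
  by rewrite compmDl compmDr !ntP.
- by move=> F G a; apply: nattrans_ext => x /=; apply: comp1m.
- by move=> F G a; apply: nattrans_ext => x /=; apply: compm1.
- by move=> F G H K c b a; apply: nattrans_ext => x /=; apply: compmA.
- by move=> F G a b c; apply: nattrans_ext => x /=; apply: homDA.
- by move=> F G a b; apply: nattrans_ext => x /=; apply: homDC.
- by move=> F G a; apply: nattrans_ext => x /=; apply: hom0D.
- by move=> F G a; apply: nattrans_ext => x /=; apply: homND.
- by move=> F G H a b c; apply: nattrans_ext => x /=; apply: compmDl.
- by move=> F G H a b c; apply: nattrans_ext => x /=; apply: compmDr.
Defined.

Definition op (A : precat) : precat.
Proof.
unshelve refine (@Precat A (fun x y => @hom A y x) (@idm A)
  (fun x y z g f => f \co g) (fun x y => hom0 y x) (fun x y f => homN f)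
  (fun x y f g => homD f g) _ _ _ _ _ _ _ _ _) => /=.
- by move=> x y f; apply: compm1.
- by move=> x y f; apply: comp1m.
- by move=> x y z t h g f; rewrite compmA.
- by move=> x y; apply: homDA.
- by move=> x y; apply: homDC.
- by move=> x y; apply: hom0D.
- by move=> x y; apply: homND.
- by move=> x y z g g' f; apply: compmDr.
- by move=> x y z g f f'; apply: compmDl.
Defined.

Definition full_subcat (C : precat) (Q : C -> Prop) : precat.
Proof.
unshelve refine (@Precat {x : C | Q x} (fun x y => hom (sval x) (sval y))
  (fun x => idm (sval x)) (fun x y z g f => g \co f) (fun x y => hom0 _ _)
  (fun x y f => homN f) (fun x y f g => homD f g) _ _ _ _ _ _ _ _ _) => /=.
- by move=> x y f; apply: comp1m.
- by move=> x y f; apply: compm1.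
- by move=> x y z t h g f; apply: compmA.
- by move=> x y; apply: homDA.
- by move=> x y; apply: homDC.
- by move=> x y; apply: hom0D.
- by move=> x y; apply: homND.
- by move=> x y z g g' f; apply: compmDl.
- by move=> x y z g f f'; apply: compmDr.
Defined.

Definition full_incl (C : precat) (Q : C -> Prop) : functor (full_subcat Q) C.
Proof. by exists (fun x => sval x) (fun x y f => f). Defined.

Section ArrowCategory.
Variable C : precat.

Record arrow := Arrow { asrc : C; atgt : C; amor :> hom asrc atgt }.

Record square (f g : arrow) := Square {
  sq_src : hom (asrc f) (asrc g);
  sq_tgt : hom (atgt f) (atgt g);
  squareP : sq_tgt \co f = g \co sq_src
}.

Lemma square_ext f g (s t : square f g) :
  sq_src s = sq_src t -> sq_tgt s = sq_tgt t -> s = t.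
Proof.
case: s t => [s1 s2 sP] [t1 t2 tP] /= e1 e2.
by subst t1 t2; congr Square; apply: Prop_irrelevance.
Qed.

Definition arrow_cat : precat.
Proof.
unshelve refine (@Precat arrow square _ _ _ _ _ _ _ _ _ _ _ _ _ _).
- by move=> f; exists (idm _) (idm _); rewrite comp1m compm1.
- move=> f g h t s; exists (sq_src t \co sq_src s) (sq_tgt t \co sq_tgt s).
  by rewrite -compmA squareP compmA squareP compmA.
- by move=> f g; exists (hom0 _ _) (hom0 _ _); rewrite comp0m compm0.
- move=> f g s; exists (homN (sq_src s)) (homN (sq_tgt s)).
  by rewrite compNm compmN squareP.
- move=> f g s t.
  exists (homD (sq_src s) (sq_src t)) (homD (sq_tgt s) (sq_tgt t)).
  by rewrite compmDl compmDr !squareP.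
- by move=> f g s; apply: square_ext; apply: comp1m.
- by move=> f g s; apply: square_ext; apply: compm1.
- by move=> f g h k s t u; apply: square_ext; apply: compmA.
- by move=> f g s t u; apply: square_ext; apply: homDA.
- by move=> f g s t; apply: square_ext; apply: homDC.
- by move=> f g s; apply: square_ext; apply: hom0D.
- by move=> f g s; apply: square_ext; apply: homND.
- by move=> f g h s t u; apply: square_ext; apply: compmDl.
- by move=> f g h s t u; apply: square_ext; apply: compmDr.
Defined.

Definition monomorphism (x y : C) (f : hom x y) : Prop :=
  forall z (u v : hom z x), f \co u = f \co v -> u = v.

Definition mono_cat : precat :=
  @full_subcat arrow_cat (fun f : arrow => monomorphism f).

Definition mono_incl : functor mono_cat arrow_cat := full_incl _.

End ArrowCategory.

Definition arrow_functor (A B : precat) (F : functor A B) :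
  functor (arrow_cat A) (arrow_cat B).
Proof.
unshelve refine (@Functor (arrow_cat A) (arrow_cat B)
  (fun f => Arrow (fmor F (amor f)))
  (fun f g (s : square f g) => @Square _ (Arrow (fmor F f)) (Arrow (fmor F g))
     (fmor F (sq_src s)) (fmor F (sq_tgt s)) _) _ _ _).
- by rewrite /= -!fmor_comp squareP.
- by move=> f; apply: square_ext; apply: fmor1.
- by move=> f g h t s; apply: square_ext; apply: fmor_comp.
- by move=> f g s t; apply: square_ext; apply: fmorD.
Defined.

Definition zero_object (C : precat) (x : C) : Prop :=
  (forall y (h : hom x y), h = hom0 x y) /\ (forall y (h : hom y x), h = hom0 y x).

Definition isomorphic (C : precat) (x y : C) : Prop :=
  exists (f : hom x y) (g : hom y x), g \co f = idm x /\ f \co g = idm y.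

Section FunctorProperties.
Variables (C D : precat) (F : functor C D).

Definition full : Prop :=
  forall (x y : C) (h : hom (F x) (F y)), exists k : hom x y, fmor F k = h.

Definition dense : Prop := forall d : D, exists c : C, isomorphic (F c) d.

Definition objective : Prop :=
  forall (x y : C) (h : hom x y), fmor F h = hom0 (F x) (F y) ->
    exists (k : C) (f : hom x k) (g : hom k y),
      zero_object (F k) /\ h = g \co f.

(* F is left adjoint to U: a unit eta that is universal from each c to U. *)
Definition left_adjoint (U : functor D C) : Prop :=
  exists eta : nattrans (functor_id C) (functor_comp U F),
    forall (c : C) (d : D) (g : hom c (U d)),
      exists! h : hom (F c) d, fmor U h \co eta c = g.

End FunctorProperties.

Lemma additive_ext (A B : zmodType) (f g : {additive A -> B}) : f =1 g -> f = g.
Proof.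
case: f g => [f [[fP]]] [g [[gP]]] /= /funext efg.
by subst g; rewrite (Prop_irrelevance fP gP).
Qed.

Definition ab_cat : precat.
Proof.
unshelve refine (@Precat zmodType (fun A B => {additive A -> B})
  (fun A => idfun) (fun A B C g f => g \o f) (fun A B => \0)
  (fun A B f => \- f) (fun A B f g => f \+ g) _ _ _ _ _ _ _ _ _).
- by move=> A B f; apply: additive_ext.
- by move=> A B f; apply: additive_ext.
- by move=> A B C D h g f; apply: additive_ext.
- by move=> A B f g h; apply: additive_ext => x /=; rewrite addrA.
- by move=> A B f g; apply: additive_ext => x /=; rewrite addrC.
- by move=> A B f; apply: additive_ext => x /=; rewrite add0r.
- by move=> A B f; apply: additive_ext => x /=; rewrite addNr.
- by move=> A B C g g' f; apply: additive_ext.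
- by move=> A B C g f f'; apply: additive_ext => x /=; rewrite raddfD.
Defined.

Section LinearMaps.
Variables (R : pzRingType) (M N : lmodType R).

Lemma linear_ext (f g : {linear M -> N}) : f =1 g -> f = g.
Proof.
case: f g => [f [[fP] [fZ]]] [g [[gP] [gZ]]] /= /funext efg.
by subst g; rewrite (Prop_irrelevance fP gP) (Prop_irrelevance fZ gZ).
Qed.

HB.instance Definition _ := gen_eqMixin {linear M -> N}.
HB.instance Definition _ := gen_choiceMixin {linear M -> N}.

Let lin0 : {linear M -> N} := \0.
Let linN (f : {linear M -> N}) : {linear M -> N} := \- f.
Let linD (f g : {linear M -> N}) : {linear M -> N} := f \+ g.

Let linDA : associative linD.
Proof. by move=> f g h; apply: linear_ext => x /=; rewrite addrA. Qed.
Let linDC : commutative linD.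
Proof. by move=> f g; apply: linear_ext => x /=; rewrite addrC. Qed.
Let lin0D : left_id lin0 linD.
Proof. by move=> f; apply: linear_ext => x /=; rewrite add0r. Qed.
Let linND : left_inverse lin0 linN linD.
Proof. by move=> f; apply: linear_ext => x /=; rewrite addNr. Qed.

HB.instance Definition _ :=
  GRing.isZmodule.Build {linear M -> N} linDA linDC lin0D linND.

End LinearMaps.

Definition module_cat (R : pzRingType) : precat.
Proof.
unshelve refine (@Precat (lmodType R) (fun M N => {linear M -> N})
  (fun M => idfun) (fun M N P g f => g \o f) (fun M N => 0)
  (fun M N f => - f) (fun M N f g => f + g) _ _ _ _ _ _ _ _ _).
- by move=> M N f; apply: linear_ext.
- by move=> M N f; apply: linear_ext.
- by move=> M N P Q h g f; apply: linear_ext.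
- by move=> M N f g h; apply: addrA.
- by move=> M N f g; apply: addrC.
- by move=> M N f; apply: add0r.
- by move=> M N f; apply: addNr.
- by move=> M N P g g' f; apply: linear_ext.
- by move=> M N P g f f'; apply: linear_ext => x /=; rewrite raddfD.
Defined.

Lemma monomorphismP (R : pzRingType) (M N : lmodType R) (f : {linear M -> N}) :
  @monomorphism (module_cat R) M N f <-> injective f.
Proof.
split=> [fmono x y efxy|finj P u v efuv].
- have scaleP (z : M) : linear (fun r : R^o => (r : R) *: z).
    by move=> a r s; rewrite scalerDl scalerA.
  pose sc z : {linear R^o -> M} :=
    HB.pack (fun r : R^o => (r : R) *: z) (GRing.isLinear.Build _ _ _ _ _ (scaleP z)).
  have /(congr1 (fun h : {linear R^o -> M} => h (1 : R))) : sc x = sc y.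
    apply: (fmono (R^o : lmodType R)); apply: linear_ext => r /=.
    by rewrite !linearZ_LR /= efxy.
  by rewrite /= !scale1r.
- apply: linear_ext => z; apply: finj.
  by have /(congr1 (fun h : {linear P -> N} => h z)) := efuv.
Qed.

Definition fp_cat (R : pzRingType) : precat :=
  @full_subcat (module_cat R) (@finitely_presented R).

Definition ab_presheaf (A : precat) : precat := functor_cat (op A) ab_cat.

Section Presheaf.
Variables (A : precat) (F : ab_presheaf A).

Definition psh_val (x : A) : zmodType := (F : functor _ _) x.

Definition psh_res (x y : A) (h : hom x y) : {additive psh_val y -> psh_val x} :=
  fmor (F : functor (op A) ab_cat) h.

End Presheaf.

Section PresheafTheory.
Variables (A : precat) (F : ab_presheaf A).

Lemma psh_res1 x u : psh_res F (idm x) u = u.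
Proof. by rewrite /psh_res (fmor1 (F : functor (op A) ab_cat) x). Qed.

Lemma psh_res_comp x y z (g : hom y z) (f : hom x y) u :
  psh_res F (g \co f) u = psh_res F f (psh_res F g u).
Proof. by rewrite /psh_res (fmor_comp (F : functor (op A) ab_cat) f g). Qed.

Lemma psh_resD x y (f g : hom x y) u :
  psh_res F (homD f g) u = psh_res F f u + psh_res F g u.
Proof. by rewrite /psh_res (fmorD (F : functor (op A) ab_cat) f g). Qed.

Variable G : ab_presheaf A.

Definition psh_app (a : hom F G) (x : A) : {additive psh_val F x -> psh_val G x} :=
  (a : nattrans F G) x.

Lemma psh_appP (a : hom F G) x y (f : hom x y) u :
  psh_app a x (psh_res F f u) = psh_res G f (psh_app a y u).
Proof.
have := congr1 (fun h : {additive psh_val F y -> psh_val G x} => h u)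
  (@ntP (op A) ab_cat F G a y x f).
exact.
Qed.

Lemma psh_app_ext (a b : hom F G) :
  (forall x u, psh_app a x u = psh_app b x u) -> a = b.
Proof. by move=> eab; apply: nattrans_ext => x; apply: additive_ext => u; apply: eab. Qed.

End PresheafTheory.

Section QuotientFunctor.
Variables (A : precat) (F : ab_presheaf A).

Record subfunctor := Subfunctor {
  sfpred :> forall x : A, psh_val F x -> Prop;
  sf0 : forall x, @sfpred x 0;
  sfB : forall x u v, @sfpred x u -> @sfpred x v -> @sfpred x (u - v);
  sf_res : forall (x y : A) (h : hom x y) u,
    @sfpred y u -> @sfpred x (psh_res F h u)
}.

Variable S : subfunctor.

Definition sf_mem (x : A) (u : psh_val F x) : bool := `[< S x u >].

Fact sf_zmod_closed x : zmod_closed (@sf_mem x).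
Proof.
split; first by apply/asboolP/sf0.
by move=> u v /asboolP Su /asboolP Sv; apply/asboolP/sfB.
Qed.

HB.instance Definition _ x :=
  GRing.isZmodClosed.Build (psh_val F x) (@sf_mem x) (@sf_zmod_closed x).

Definition sf_closed (x : A) : zmodClosed (psh_val F x) :=
  GRing.ZmodClosed.clone _ (@sf_mem x) _.

Definition quot_ob (x : A) : zmodType := Quotient.quot (sf_closed x).

Definition quot_pi (x : A) : {additive psh_val F x -> quot_ob x} :=
  \pi_(Quotient.quot (sf_closed x)).

Lemma quot_piP x u v : quot_pi x u = quot_pi x v <-> S x (u - v).
Proof.
split=> [/eqP|Suv]; last apply/eqP.
  by rewrite /= -Quotient.idealrBE => /asboolP.
by rewrite /= -Quotient.idealrBE; apply/asboolP.
Qed.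

Lemma quot_reprK x (q : quot_ob x) : quot_pi x (repr q) = q.
Proof. exact: reprK. Qed.

Lemma quot_pi_eq0 x u : quot_pi x u = 0 <-> S x u.
Proof. by rewrite -(raddf0 (quot_pi x)) quot_piP subr0. Qed.

Lemma quot_resP (x y : A) (h : hom x y) u v : quot_pi y u = quot_pi y v ->
  quot_pi x (psh_res F h u) = quot_pi x (psh_res F h v).
Proof. by move=> /quot_piP Suv; apply/quot_piP; rewrite -raddfB; apply: sf_res. Qed.

Definition quot_res_fun (x y : A) (h : hom x y) (q : quot_ob y) : quot_ob x :=
  quot_pi x (psh_res F h (repr q)).

Lemma quot_res_pi (x y : A) (h : hom x y) u :
  quot_res_fun h (quot_pi y u) = quot_pi x (psh_res F h u).
Proof. exact/quot_resP/quot_reprK. Qed.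

Fact quot_res_additive (x y : A) (h : hom x y) : zmod_morphism (quot_res_fun h).
Proof.
move=> q r; rewrite -[q]quot_reprK -[r]quot_reprK -raddfB !quot_res_pi.
by rewrite !raddfB.
Qed.

HB.instance Definition _ (x y : A) (h : hom x y) :=
  GRing.isZmodMorphism.Build _ _ (quot_res_fun h) (quot_res_additive h).

Definition quot_functor : ab_presheaf A.
Proof.
unshelve refine (@Functor (op A) ab_cat quot_ob
  (fun x y (h : @hom A y x) =>
     GRing.Additive.clone _ _ (quot_res_fun h) _) _ _ _).
- move=> x; apply: additive_ext => q /=.
  by rewrite -[q]quot_reprK quot_res_pi psh_res1.
- move=> x y z g f; apply: additive_ext => q /=.
  by rewrite -[q]quot_reprK !quot_res_pi psh_res_comp.
- move=> x y f g; apply: additive_ext => q /=.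
  by rewrite -[q]quot_reprK !quot_res_pi psh_resD raddfD.
Defined.

Definition quot_proj : hom F quot_functor.
Proof.
exists (fun x => quot_pi x) => x y h; apply: additive_ext => u.
by rewrite /= quot_res_pi.
Defined.

Section QuotientLift.
Variables (G : ab_presheaf A) (a : hom F G).
Hypothesis aS : forall x u, S x u -> psh_app a x u = 0.

Definition quot_lift_fun (x : A) (q : quot_ob x) : psh_val G x :=
  psh_app a x (repr q).

Lemma quot_lift_pi x u : quot_lift_fun (quot_pi x u) = psh_app a x u.
Proof.
apply/eqP; rewrite -subr_eq0 -raddfB; apply/eqP/aS/quot_piP.
exact: quot_reprK.
Qed.

Fact quot_lift_additive x : zmod_morphism (@quot_lift_fun x).
Proof.
move=> q r; rewrite -[q]quot_reprK -[r]quot_reprK -raddfB !quot_lift_pi.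
by rewrite raddfB.
Qed.

HB.instance Definition _ x :=
  GRing.isZmodMorphism.Build _ _ (@quot_lift_fun x) (@quot_lift_additive x).

Definition quot_lift : hom quot_functor G.
Proof.
unshelve refine (@Nattrans (op A) ab_cat quot_functor G
  (fun x => GRing.Additive.clone _ _ (@quot_lift_fun x) _) _).
move=> x y h; apply: additive_ext => q.
rewrite /= -[q]quot_reprK quot_res_pi !quot_lift_pi.
exact: psh_appP.
Defined.

Lemma quot_lift_proj : quot_lift \co quot_proj = a.
Proof. by apply: psh_app_ext => x u; apply: quot_lift_pi. Qed.

End QuotientLift.

Lemma quot_proj_epi (G : ab_presheaf A) (a b : hom quot_functor G) :
  a \co quot_proj = b \co quot_proj -> a = b.
Proof.
move=> eab; apply: psh_app_ext => x q; rewrite -[q]quot_reprK.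
by have /(congr1 (fun c : hom F G => psh_app c x (repr q))) := eab.
Qed.

End QuotientFunctor.

(* The functor induced on quotients, for any choice of a subfunctor S F of
   each F respected by all natural transformations. *)
Section QuotientFunctoriality.
Variables (C A : precat) (T : functor C (ab_presheaf A)).
Variable S : forall c : C, subfunctor (T c).
Hypothesis TS : forall (c d : C) (f : hom c d) x u,
  S c x u -> S d x (psh_app (fmor T f) x u).

Fact quot_map_subproof c d (f : hom c d) x u : S c x u ->
  psh_app (quot_proj (S d) \co fmor T f) x u = 0.
Proof. by move=> Su; apply/quot_pi_eq0/TS. Qed.

Definition quot_map : functor C (ab_presheaf A).
Proof.
unshelve refine (@Functor C (ab_presheaf A) (fun c => quot_functor (S c))
  (fun c d f => quot_lift (@quot_map_subproof c d f)) _ _ _).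
- by move=> c; apply: quot_proj_epi; rewrite quot_lift_proj fmor1 comp1m compm1.
- move=> c d e g f; apply: quot_proj_epi.
  by rewrite -[RHS]compmA !quot_lift_proj fmor_comp !compmA quot_lift_proj.
- move=> c d f g; apply: quot_proj_epi.
  by rewrite compmDl !quot_lift_proj fmorD compmDr.
Defined.

End QuotientFunctoriality.

Section Cokernel.
Variable A : precat.

Definition image_sub (f : arrow (ab_presheaf A)) : subfunctor (atgt f).
Proof.
exists (fun x v => exists u, psh_app f x u = v).
- by move=> x; exists 0; rewrite raddf0.
- by move=> x _ _ [u <-] [v <-]; exists (u - v); rewrite raddfB.
- by move=> x y h _ [u <-]; exists (psh_res (asrc f) h u); rewrite psh_appP.
Defined.

Definition arrow_tgt (C : precat) : functor (arrow_cat C) C.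
Proof. by exists (fun f : arrow C => atgt f) (fun f g (s : square f g) => sq_tgt s). Defined.

Fact image_sub_nat (f g : arrow_cat (ab_presheaf A)) (s : hom f g) x u :
  image_sub f x u -> image_sub g x (psh_app (fmor (arrow_tgt _) s) x u).
Proof.
case=> v <-; exists (psh_app (sq_src s) x v).
by have /(congr1 (fun c : hom _ _ => psh_app c x v)) := squareP s.
Qed.

Definition cokernel : functor (arrow_cat (ab_presheaf A)) (ab_presheaf A) :=
  @quot_map _ A (arrow_tgt (ab_presheaf A)) image_sub image_sub_nat.

End Cokernel.

Section Vanishing.
Variables (A : precat) (Q : A -> Prop).

Definition vanishing (F : ab_presheaf A) : Prop :=
  forall x, Q x -> forall u : psh_val F x, u = 0.

Definition vanishing_cat : precat := full_subcat vanishing.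

Definition vanishing_incl : functor vanishing_cat (ab_presheaf A) := full_incl _.

(* The subfunctor generated by the values of F on Q. *)
Inductive trace (F : ab_presheaf A) (x : A) : psh_val F x -> Prop :=
| trace0 : trace 0
| traceD q (h : hom x q) v u : Q q -> trace u -> trace (psh_res F h v + u).

Lemma trace_add F x (u v : psh_val F x) : trace u -> trace v -> trace (u + v).
Proof.
by move=> tu tv; elim: tu => [|q h w {}u Qq _ IH]; rewrite ?add0r // -addrA; apply: traceD.
Qed.

Definition trace_sub (F : ab_presheaf A) : subfunctor F.
Proof.
exists (@trace F).
- exact: trace0.
- move=> x u v tu tv; apply: trace_add tu _.
  elim: tv => [|q h w {}v Qq _ IH]; first by rewrite oppr0; apply: trace0.
  by rewrite opprD -raddfN; apply: traceD.
- move=> x y h u; elim=> [|q k w {}u Qq _ IH]; first by rewrite raddf0; apply: trace0.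
  by rewrite raddfD -psh_res_comp; apply: traceD.
Defined.

Fact trace_nat (F G : ab_presheaf A) (a : hom F G) x u :
  trace_sub F x u -> trace_sub G x (psh_app (fmor (functor_id _) a) x u).
Proof.
rewrite /=; elim=> [|q h w {}u Qq _ IH]; first by rewrite raddf0; apply: trace0.
by rewrite raddfD psh_appP; apply: traceD.
Qed.

Definition mod_trace : functor (ab_presheaf A) (ab_presheaf A) :=
  @quot_map _ A (functor_id (ab_presheaf A)) trace_sub trace_nat.

Fact mod_trace_vanishing (F : ab_presheaf A) : vanishing (mod_trace F).
Proof.
move=> x Qx q; rewrite -[q]quot_reprK; apply/quot_pi_eq0.
by rewrite -[repr q]psh_res1 -[psh_res _ _ _]addr0; apply: traceD => //; apply: trace0.
Qed.

Definition vanishing_refl : functor (ab_presheaf A) vanishing_cat.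
Proof.
unshelve refine (@Functor (ab_presheaf A) vanishing_cat
  (fun F => exist _ (mod_trace F) (@mod_trace_vanishing F))
  (fun F G a => fmor mod_trace a) _ _ _).
- by move=> F; apply: (fmor1 mod_trace).
- by move=> F G H b a; apply: (fmor_comp mod_trace).
- by move=> F G a b; apply: (fmorD mod_trace).
Defined.

Theorem vanishing_refl_adjoint : left_adjoint vanishing_refl vanishing_incl.
Proof.
unshelve eexists.
  exists (fun F => quot_proj (trace_sub F)) => F G a.
  exact/esym/quot_lift_proj.
move=> F [G vG] a /=.
have aS x u : trace_sub F x u -> psh_app a x u = 0.
  elim=> [|q h w {}u Qq _ IH]; first by rewrite raddf0.
  by rewrite raddfD psh_appP IH addr0 (vG q Qq (psh_app a q w)) raddf0.
exists (quot_lift aS); split; first exact: quot_lift_proj.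
by move=> b eb; apply: quot_proj_epi; rewrite quot_lift_proj -eb.
Qed.

End Vanishing.

Section HomFunctor.
Variable R : pzRingType.

Section Composition.
Variables M N P : lmodType R.

Definition precomp (h : {linear M -> N}) (f : {linear N -> P}) : {linear M -> P} :=
  f \o h.

Definition postcomp (f : {linear N -> P}) (h : {linear M -> N}) : {linear M -> P} :=
  f \o h.

Fact precomp_additive h : zmod_morphism (precomp h).
Proof. by move=> f g; apply: linear_ext. Qed.

Fact postcomp_additive f : zmod_morphism (postcomp f).
Proof. by move=> g h; apply: linear_ext => x; apply: raddfB. Qed.

HB.instance Definition _ h :=
  GRing.isZmodMorphism.Build _ _ (precomp h) (precomp_additive h).

HB.instance Definition _ f :=
  GRing.isZmodMorphism.Build _ _ (postcomp f) (postcomp_additive f).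

End Composition.

Definition hom_presheaf (N : lmodType R) : ab_presheaf (fp_cat R).
Proof.
unshelve refine (@Functor (op (fp_cat R)) ab_cat
  (fun M => {linear (sval M : lmodType R) -> N} : zmodType)
  (fun M M' (h : {linear (sval M' : lmodType R) -> (sval M : lmodType R)}) =>
     GRing.Additive.clone _ _ (@precomp _ _ N h) _) _ _ _).
- by move=> M; apply: additive_ext => f; apply: linear_ext.
- by move=> M M' M'' g h; apply: additive_ext => f; apply: linear_ext.
- move=> M M' g h; apply: additive_ext => f; apply: linear_ext => x.
  exact: raddfD.
Defined.

Definition hom_functor : functor (module_cat R) (ab_presheaf (fp_cat R)).
Proof.
unshelve refine (@Functor (module_cat R) (ab_presheaf (fp_cat R)) hom_presheaf
  (fun N P (f : {linear N -> P}) =>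
     @Nattrans _ _ (hom_presheaf N) (hom_presheaf P)
       (fun M => GRing.Additive.clone _ _ (@postcomp (sval M) _ _ f) _) _) _ _ _).
- by move=> M M' h; apply: additive_ext => g; apply: linear_ext.
- by move=> N; apply: nattrans_ext => M; apply: additive_ext => g; apply: linear_ext.
- by move=> N P Q g f; apply: nattrans_ext => M; apply: additive_ext => h;
    apply: linear_ext.
- by move=> N P f g; apply: nattrans_ext => M; apply: additive_ext => h;
    apply: linear_ext.
Defined.

End HomFunctor.

Section Theta.
Variable R : pzRingType.

Definition H_cat : precat := arrow_cat (module_cat R).
Definition S_cat : precat := mono_cat (module_cat R).

Definition Sigma : functor H_cat (ab_presheaf (fp_cat R)) :=
  functor_comp (cokernel (fp_cat R)) (arrow_functor (hom_functor R)).

Definition fp_projective (M : fp_cat R) : Prop := projective_module (sval M).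

(* Additive functors on the stable category of R-mod are identified with the
   additive functors on R-mod that vanish on projective modules. *)
Definition stable_presheaf : precat := vanishing_cat fp_projective.

(* Left adjoint to the inclusion by vanishing_refl_adjoint. *)
Definition i_lambda : functor (ab_presheaf (fp_cat R)) stable_presheaf :=
  vanishing_refl fp_projective.

Definition Theta : functor S_cat stable_presheaf :=
  functor_comp i_lambda (functor_comp Sigma (mono_incl (module_cat R))).

End Theta.

(* Main.v *)
(* Every module over a ring of finite representation type is pure-projective:
   a lifting problem that is solvable on each finitely presented module C -> Y,
   compatibly with precomposition and subtraction, is solved by one linear map
   on Y (local_lifting).  By Zorn's lemma this reduces to finding, in a nonzero
   quotient of Y, a pure finitely presented indecomposable submodule; without
   one, non-split factorizations would give an infinite chain of non-isomorphisms
   between indecomposables of bounded length with nonzero composites, against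
   the Harada-Sai lemma.  Finite length of R comes from the double annihilator
   property of self-injective rings.

   Fullness: a natural transformation lifts to k : Y -> Y'; then k f = f' u + d p
   with d : P -> Y' a free cover, and p extends from X to Y because P, pure in
   an injective product of copies of R, is injective; k - d p is the required map.
   Objectivity: a map killed by Theta has the form f' u + d p, hence factors
   through a monomorphism into X' + P, which Theta kills.
   Density: present a functor by a map b : B -> Y of direct sums of finitely
   presented modules and replace b by (b, i) : B -> Y + E, where i embeds B in a
   direct sum E of free modules, R being an injective cogenerator. *)

Require Import Defs.
From mathcomp Require Import all_boot all_order all_algebra.
From HB Require Import structures.
From mathcomp Require Import boolp classical_sets.

Set Implicit Arguments.
Unset Strict Implicit.
Unset Printing Implicit Defensive.

Import GRing.Theory.
Local Open Scope ring_scope.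
Local Open Scope quotient_scope.

(** * Building linear maps; pairs and free modules *)

Section LinearMapConstruction.
Variables (R : pzRingType) (A B : lmodType R).

Section OfFunction.
Variables (f : A -> B) (f_lin : linear f).
(** The linearity proof is an argument of this alias, so that instance inference can recover it from
    the term. *)
Definition mklin_fun of linear f := f.
HB.instance Definition _ :=
  GRing.isLinear.Build R A B *:%R (mklin_fun f_lin) f_lin.
Definition mklin : {linear A -> B} := mklin_fun f_lin.
Lemma mklinE x : mklin x = f x. Proof. by []. Qed.
End OfFunction.

(** Two values over the same point differ by a value over 0, so a trivial fibre over 0 makes the
    relation single-valued, and linearity of the chosen function follows from uniqueness. *)
Lemma linear_of_graph (G : A -> B -> Prop) :
  (forall c x y u v, G x u -> G y v -> G (c *: x + y) (c *: u + v)) ->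
  (forall x, exists u, G x u) -> (forall u, G 0 u -> u = 0) ->
  exists f : {linear A -> B}, (forall x, G x (f x)) /\ (forall x u, G x u -> f x = u).
Proof.
move=> Glin Gtot Gfun.
have Guniq x u v : G x u -> G x v -> u = v.
  move=> Gu Gv; have := Glin (-1) _ _ _ _ Gu Gv.
  by rewrite !scaleN1r addNr => /Gfun/eqP; rewrite addrC subr_eq0 => /eqP.
pose f x := sval (cid (Gtot x)); have fG x : G x (f x) by exact: svalP.
have f_lin : linear f by move=> c x y; apply: Guniq (fG _) (Glin _ _ _ _ _ (fG x) (fG y)).
by exists (mklin f_lin); split=> // x u /(Guniq _ _ _ (fG x)).
Qed.

Lemma lin_addE (f g : {linear A -> B}) x : (f + g) x = f x + g x.
Proof. by []. Qed.
Lemma lin_subE (f g : {linear A -> B}) x : (f - g) x = f x - g x.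
Proof. by []. Qed.
Lemma lin_sumE I (r : seq I) (F : I -> {linear A -> B}) x :
  (\sum_(i <- r) F i) x = \sum_(i <- r) F i x.
Proof. by elim: r => [|i r IH]; rewrite ?big_nil ?big_cons //= -IH. Qed.

End LinearMapConstruction.

Section PairMaps.
Variables (R : pzRingType) (A B C : lmodType R).

Fact pair_lin_linear (f : {linear C -> A}) (g : {linear C -> B}) :
  linear (fun x => (f x, g x) : A * B).
Proof. by move=> c x y; rewrite !linearP. Qed.
Definition pair_lin f g : {linear C -> (A * B)%type} := mklin (pair_lin_linear f g).

Fact copair_lin_linear (f : {linear A -> C}) (g : {linear B -> C}) :
  linear (fun x : A * B => f x.1 + g x.2).
Proof. by move=> c x y; rewrite !linearP scalerDr addrACA. Qed.
Definition copair_lin f g : {linear (A * B)%type -> C} := mklin (copair_lin_linear f g).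
Lemma copair_linE f g x : copair_lin f g x = f x.1 + g x.2. Proof. by []. Qed.

Fact fst_lin_linear : linear (fun x : A * B => x.1). Proof. by []. Qed.
Definition fst_lin : {linear (A * B)%type -> A} := mklin fst_lin_linear.
Fact snd_lin_linear : linear (fun x : A * B => x.2). Proof. by []. Qed.
Definition snd_lin : {linear (A * B)%type -> B} := mklin snd_lin_linear.

End PairMaps.

Section FreeModules.
Variables (R : pzRingType) (M : lmodType R).

Fact row_lin_linear n (y : 'I_n -> M) : linear (fun v : 'rV[R]_n => \sum_i v 0 i *: y i).
Proof.
move=> c u v; rewrite scaler_sumr -big_split; apply: eq_bigr => i _.
by rewrite !mxE scalerDl scalerA.
Qed.
Definition row_lin n (y : 'I_n -> M) : {linear 'rV[R]_n -> M} := mklin (row_lin_linear y).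

Lemma row_lin_delta n (y : 'I_n -> M) i : row_lin y (delta_mx 0 i) = y i.
Proof.
rewrite mklinE (bigD1 i) //= big1 ?addr0 => [|j ji]; rewrite mxE eqxx /=.
  by rewrite eqxx scale1r.
by rewrite (negPf ji) scale0r.
Qed.

Lemma row_lin_ext n (f g : {linear 'rV[R]_n -> M}) :
  (forall i, f (delta_mx 0 i) = g (delta_mx 0 i)) -> f = g.
Proof.
move=> efg; apply: linear_ext => v; rewrite [v]row_sum_delta !linear_sum.
by apply: eq_bigr => i _; rewrite !linearZ_LR /= efg.
Qed.

End FreeModules.

(** * Submodules, quotient modules and factorization of maps *)

Section Submodules.
Variable R : pzRingType.
Implicit Types M A B : lmodType R.

Definition submod M (N : M -> Prop) : Prop :=
  N 0 /\ forall c x y, N x -> N y -> N (c *: x + y).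

Section Closure.
Variables (M : lmodType R) (N : M -> Prop).
Hypothesis sN : submod N.
Lemma submod0 : N 0. Proof. by case: sN. Qed.
Lemma submodP c x y : N x -> N y -> N (c *: x + y). Proof. by case: sN => _; apply. Qed.
Lemma submodZ c x : N x -> N (c *: x).
Proof. by move=> Nx; rewrite -[_ *: _]addr0; apply: submodP => //; apply: submod0. Qed.
Lemma submodD x y : N x -> N y -> N (x + y).
Proof. by move=> Nx Ny; rewrite -[x]scale1r; apply: submodP. Qed.
Lemma submodN x : N x -> N (- x). Proof. by rewrite -scaleN1r; apply: submodZ. Qed.
Lemma submodB x y : N x -> N y -> N (x - y).
Proof. by move=> Nx /submodN; apply: submodD. Qed.
Lemma submod_sum I (r : seq I) (F : I -> M) : (forall i, N (F i)) -> N (\sum_(i <- r) F i).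
Proof. by move=> NF; elim/big_ind: _ => //; [apply: submod0 | apply: submodD]. Qed.
End Closure.

Lemma submod_preim A B (f : {linear A -> B}) (N : B -> Prop) :
  submod N -> submod (fun x => N (f x)).
Proof.
move=> sN; split=> [|c x y Nx Ny]; rewrite ?linear0 ?linearP; first exact: submod0.
exact: submodP.
Qed.

Lemma submod_image A B (f : {linear A -> B}) (N : A -> Prop) :
  submod N -> submod (fun y => exists x, N x /\ f x = y).
Proof.
move=> sN; split=> [|c _ _ [x [Nx <-]] [y [Ny <-]]].
  by exists 0; rewrite linear0; split=> //; apply: submod0.
by exists (c *: x + y); rewrite linearP; split=> //; apply: submodP.
Qed.

Lemma submod_ker A B (f : {linear A -> B}) : submod (fun x => f x = 0).
Proof. by split=> [|c x y ex ey]; rewrite ?linear0 // linearP ex ey scaler0 addr0. Qed.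

Lemma submod_range A B (f : {linear A -> B}) : submod (fun y => exists x, f x = y).
Proof.
split=> [|c _ _ [x <-] [y <-]]; first by exists 0; rewrite linear0.
by exists (c *: x + y); rewrite linearP.
Qed.

Lemma submod_add M (U V : M -> Prop) : submod U -> submod V ->
  submod (fun x => exists u v, [/\ U u, V v & x = u + v]).
Proof.
move=> sU sV; split=> [|c _ _ [u [v [Uu Vv ->]]] [u' [v' [Uu' Vv' ->]]]].
  by exists 0, 0; rewrite addr0; split=> //; apply: submod0.
exists (c *: u + u'), (c *: v + v'); rewrite scalerDr addrACA.
by split=> //; apply: submodP.
Qed.

Lemma submod_full M : submod (fun _ : M => True). Proof. by []. Qed.

Lemma submod_zero M : submod (fun x : M => x = 0).
Proof. by split=> // c x y -> ->; rewrite scaler0 addr0. Qed.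

End Submodules.

Section SubmoduleType.
Variables (R : pzRingType) (M : lmodType R) (N : M -> Prop) (sN : submod N).

Definition submod_pred of submod N : {pred M} := fun x => `[< N x >].

Fact submod_pred_closed : GRing.submod_closed (submod_pred sN).
Proof.
split=> [|c x y /asboolP Nx /asboolP Ny]; apply/asboolP; first exact: submod0.
exact: submodP.
Qed.
HB.instance Definition _ :=
  GRing.isSubmodClosed.Build R M (submod_pred sN) submod_pred_closed.

Record submod_type := SubmodType { submod_val : M; _ : submod_val \in submod_pred sN }.
HB.instance Definition _ := [isSub for submod_val].
HB.instance Definition _ := [Choice of submod_type by <:].
HB.instance Definition _ := [SubChoice_isSubLmodule of submod_type by <:].

Definition sub_module : lmodType R := submod_type.

Fact sub_incl_linear : linear (fun x : sub_module => submod_val x).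
Proof. by []. Qed.
Definition sub_incl : {linear sub_module -> M} := mklin sub_incl_linear.

Lemma sub_incl_inj : injective sub_incl.
Proof. exact: val_inj. Qed.

Lemma sub_inclP x : N (sub_incl x).
Proof. by case: x => x px; apply/asboolP; exact: px. Qed.

Lemma sub_incl_lift x : N x -> exists y, sub_incl y = x.
Proof.
move=> Nx; have px : x \in submod_pred sN by apply/asboolP.
by exists (SubmodType px).
Qed.

Lemma sub_corestrict (A : lmodType R) (f : {linear A -> M}) : (forall x, N (f x)) ->
  exists g : {linear A -> sub_module}, forall x, sub_incl (g x) = f x.
Proof.
move=> Nf.
have [|x|u|g [gE _]] := @linear_of_graph R A sub_module (fun x y => sub_incl y = f x).
- by move=> c x y u v eu ev; rewrite !linearP eu ev.
- exact: sub_incl_lift.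
- by rewrite linear0 -(linear0 sub_incl) => /sub_incl_inj.
by exists g.
Qed.

End SubmoduleType.

Section QuotientModule.
Variables (R : pzRingType) (M : lmodType R) (N : M -> Prop) (sN : submod N).

(** The quotient group; the scalar action is put on it below through representatives. *)
Definition qmod : Type := Quotient.quot (GRing.ZmodClosed.clone _ (submod_pred sN) _).
HB.instance Definition _ := GRing.Zmodule.on qmod.

Let pi (x : M) : qmod := \pi_(Quotient.quot (GRing.ZmodClosed.clone _ (submod_pred sN) _)) x.

Let piP x y : pi x = pi y <-> N (x - y).
Proof.
split=> [/eqP|Nxy]; last apply/eqP.
  by rewrite -Quotient.idealrBE => /asboolP.
by rewrite -Quotient.idealrBE; apply/asboolP.
Qed.

Let piK (q : qmod) : pi (repr (q : Quotient.quot _)) = q.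
Proof. exact: reprK. Qed.

Let qscale (c : R) (q : qmod) : qmod := pi (c *: repr (q : Quotient.quot _)).

Let qscale_pi c x : qscale c (pi x) = pi (c *: x).
Proof.
apply/piP; rewrite -scalerBr; apply: submodZ => //; apply/piP; exact: piK.
Qed.

Let piD x y : pi (x + y) = pi x + pi y.
Proof. exact: (raddfD (\pi_(Quotient.quot (GRing.ZmodClosed.clone _ (submod_pred sN) _)))). Qed.

Fact qscaleA a b q : qscale a (qscale b q) = qscale (a * b) q.
Proof. by rewrite -[q]piK !qscale_pi scalerA. Qed.
Fact qscale1 : left_id 1 qscale.
Proof. by move=> q; rewrite -[q]piK qscale_pi scale1r. Qed.
Fact qscaleDr : right_distributive qscale +%R.
Proof. by move=> c q r; rewrite -[q]piK -[r]piK -piD !qscale_pi scalerDr piD. Qed.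
Fact qscaleDl q : {morph qscale^~ q : a b / a + b}.
Proof. by move=> a b; rewrite -[q]piK !qscale_pi scalerDl piD. Qed.

HB.instance Definition _ :=
  GRing.Zmodule_isLmodule.Build R qmod qscaleA qscale1 qscaleDr qscaleDl.

Definition quot_module : lmodType R := qmod.

Fact qproj_linear : linear (pi : M -> quot_module).
Proof. by move=> c x y; rewrite piD -qscale_pi. Qed.
Definition qproj : {linear M -> quot_module} := mklin qproj_linear.

Lemma qproj_surj q : exists x, qproj x = q.
Proof. by exists (repr (q : Quotient.quot _)); apply: piK. Qed.

Lemma qproj_eq0 x : qproj x = 0 <-> N x.
Proof. by rewrite -(linear0 qproj) piP subr0. Qed.

End QuotientModule.

Lemma linear_factor_surj (R : pzRingType) (A B C : lmodType R)
    (p : {linear A -> B}) (f : {linear A -> C}) :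
  (forall b, exists a, p a = b) -> (forall a, p a = 0 -> f a = 0) ->
  exists g : {linear B -> C}, forall a, g (p a) = f a.
Proof.
move=> psurj pf.
have [|b|u|g [_ gE]] := @linear_of_graph R B C (fun b c => exists a, p a = b /\ f a = c).
- move=> c x y u v [a [<- <-]] [a' [<- <-]].
  by exists (c *: a + a'); rewrite !linearP.
- by have [a <-] := psurj b; exists (f a), a.
- by case=> a [/pf -> <-].
by exists g => a; apply: gE; exists a.
Qed.

Lemma linear_bij_inv (R : pzRingType) (A B : lmodType R) (f : {linear A -> B}) :
  injective f -> (forall b, exists a, f a = b) ->
  exists g : {linear B -> A}, cancel f g /\ cancel g f.
Proof.
move=> finj fsurj.
have [|g gE] := @linear_factor_surj R A B A f idfun fsurj.
  by move=> a; rewrite -(linear0 f) => /finj.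
exists g; split=> // b; have [a <-] := fsurj b; by rewrite gE.
Qed.

Lemma linear_inj0 (R : pzRingType) (A B : lmodType R) (f : {linear A -> B}) :
  (forall x, f x = 0 -> x = 0) -> injective f.
Proof. by move=> f0 x y /eqP; rewrite -subr_eq0 -linearB => /eqP/f0/eqP; rewrite subr_eq0 => /eqP. Qed.

(** Since [g] kills the kernel of [f], it factors through the range of [f], and the factor extends
    along the inclusion of that range. *)
Lemma injective_module_ext (R : pzRingType) (E A B : lmodType R)
    (f : {linear A -> B}) (g : {linear A -> E}) :
  injective_module E -> (forall a, f a = 0 -> g a = 0) ->
  exists h : {linear B -> E}, forall a, h (f a) = g a.
Proof.
move=> Einj fg.
have sI := submod_range f.
have [|f' f'E] := @sub_corestrict R B _ sI A f; first by move=> x; exists x.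
have f'surj b : exists a, f' a = b.
  by have [a ea] := sub_inclP b; exists a; apply: (@sub_incl_inj _ _ _ sI); rewrite f'E.
have [|k kE] := linear_factor_surj (p := f') (f := g) f'surj.
  by move=> a e; apply: fg; rewrite -f'E e linear0.
have [h hE] := Einj _ _ (sub_incl sI) k (@sub_incl_inj _ _ _ sI).
by exists h => a; rewrite -f'E hE kE.
Qed.

(** * Finite length and strict chains of submodules *)

Section FiniteLength.
Variable R : pzRingType.
Implicit Types M A B C : lmodType R.

(** Without a minimal member, dependent choice would produce a strictly descending sequence. *)
Lemma artinian_min M (Cl : (M -> Prop) -> Prop) : artinian_module M ->
  (forall N, Cl N -> submod N) -> (exists N, Cl N) ->
  exists N, Cl N /\ forall N', Cl N' -> (forall x, N' x -> N x) -> forall x, N x -> N' x.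
Proof.
move=> artM sub [N0 CN0]; apply: contrapT => nomin.
have next (N : {N | Cl N}) : exists N' : {N | Cl N},
    (forall x, sval N' x -> sval N x) /\ ~ (forall x, sval N x -> sval N' x).
  apply: contrapT => noN'; apply: nomin; exists (sval N); split; first exact: svalP.
  move=> N' CN' leN'; apply: contrapT => nle; apply: noN'.
  by exists (exist _ N' CN').
pose step N := sval (cid (next N)); pose S n := iter n step (exist _ N0 CN0).
have stepP N := svalP (cid (next N)).
have [||n eqS] := artM (fun n x => `[< sval (S n) x >]).
- move=> n; have sS := sub _ (svalP (S n)).
  split=> [|c x y /asboolP Sx /asboolP Sy]; apply/asboolP; first exact: submod0 sS.
  exact: submodP sS _ _ _ Sx Sy.
- by move=> n x /asboolP Sx; apply/asboolP; apply: (stepP (S n)).1.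
case: (stepP (S n)) => _; apply=> x Sx.
by have /asboolP := Sx; rewrite -[`[< _ >]](eqS n.+1 (leqnSn n) x) => /asboolP.
Qed.

(* A strictly monotone bounded rank on submodules; unlike the Jordan-Hoelder
   length it need not be additive. *)
Definition strict_rank M (l : (M -> Prop) -> nat) : Prop :=
  forall U V, submod U -> submod V -> (forall x, U x -> V x) ->
    (l U <= l V)%N /\ (l U = l V -> forall x, V x -> U x).

Definition finite_length M : Prop := exists2 l : (M -> Prop) -> nat,
  strict_rank l & exists L, forall U, submod U -> (l U <= L)%N.

Lemma finite_length_surj B C (g : {linear B -> C}) :
  (forall c, exists b, g b = c) -> finite_length B -> finite_length C.
Proof.
move=> gsurj [l lS [L lL]]; exists (fun W => l (fun x => W (g x))).
  move=> U V sU sV UV.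
  have [|lUV eUV] := lS _ _ (submod_preim g sU) (submod_preim g sV); first by move=> x /UV.
  by split=> // /eUV VU c Vc; have [b eb] := gsurj c; rewrite -eb in Vc *; apply: VU.
by exists L => U sU; apply/lL/submod_preim.
Qed.

(** The rank of a submodule of [B] is the rank of its preimage in [A] plus that of its image in [C].
    If both agree for [U] inside [V], an element of [V] differs from one of [U] by an element of [V]
    in the kernel of [g], which comes from [A] and so lies in [U]. *)
Lemma finite_length_ext A B C (f : {linear A -> B}) (g : {linear B -> C}) :
  (forall b, g b = 0 -> exists a, f a = b) ->
  finite_length A -> finite_length C -> finite_length B.
Proof.
move=> kerg [la laS [La laL]] [lc lcS [Lc lcL]].
pose im (W : B -> Prop) c := exists x, W x /\ g x = c.
exists (fun W => la (fun x => W (f x)) + lc (im W))%N; last first.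
  exists (La + Lc)%N => U sU; apply: leq_add; first by apply/laL/submod_preim.
  by apply/lcL/submod_image.
move=> U V sU sV UV.
have [|la1 la2] := laS _ _ (submod_preim f sU) (submod_preim f sV); first by move=> x /UV.
have [|lc1 lc2] := lcS _ _ (submod_image g sU) (submod_image g sV).
  by move=> _ [x [Ux <-]]; exists x; split=> //; apply: UV.
split=> [|e x Vx]; first exact: leq_add.
have ea : la (fun x => U (f x)) = la (fun x => V (f x)).
  apply/eqP; rewrite eqn_leq la1 /= -(leq_add2r (lc (im U))) e leq_add2l; exact: lc1.
have ec : lc (im U) = lc (im V) by move: e; rewrite ea => /addnI.
have [y [Uy ey]] : im U (g x) by apply: lc2 => //; exists x.
have [|a ea'] := kerg (x - y); first by rewrite linearB ey subrr.
rewrite -[x](subrK y); apply: submodD => //; rewrite -ea'; apply: la2 => //.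
by rewrite ea'; apply: submodB => //; apply: UV.
Qed.

(** The rank is 1 on submodules with a nonzero element and 0 otherwise. The zero module satisfies
    the hypothesis as well. *)
Lemma finite_length_simple M :
  (forall W : M -> Prop, submod W -> (exists x, W x /\ x <> 0) -> forall x, W x) ->
  finite_length M.
Proof.
move=> simp; exists (fun W => `[< exists x, W x /\ x <> 0 >] : nat); last by exists 1%N => U _; case: asboolP.
move=> U V sU sV UV; case: (asboolP (exists x, U x /\ _)) => [nzU|zU].
  by case: asboolP => [_|[]]; [split=> // _ x _; apply: simp | case: nzU => x [/UV]; exists x].
case: asboolP => [//|zV]; split=> // _ x Vx.
have -> : x = 0 by apply: contrapT => nx; apply: zV; exists x.
exact: submod0.
Qed.

Lemma finite_length_trivial M : module_zero M -> finite_length M.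
Proof. by move=> M0; apply: finite_length_simple => W _ [x [_]]; rewrite (M0 x). Qed.

(** Starting at [K] rather than at 0 lets a chain measure the quotient by [K]: with [U] full it says
    that [M/K] has length at least [d]. *)
Fixpoint chain M d (K U : M -> Prop) : Prop :=
  if d is d'.+1 then exists K', [/\ submod K', forall x, K x -> K' x,
    ~ (forall x, K' x -> K x) & chain d' K' U]
  else forall x, K x -> U x.

Definition length_le M L : Prop :=
  forall d K, submod K -> chain d K (fun _ : M => True) -> (d <= L)%N.

Lemma finite_length_bound M : finite_length M -> exists L, length_le M L.
Proof.
move=> [l lS [L lL]]; exists L => d K sK ch.
suff : (l K + d <= L)%N by apply: leq_trans; apply: leq_addl.
elim: d K sK ch => [|d IH] K sK; first by rewrite addn0 => _; apply: lL.
case=> K' [sK' KK' nKK' /(IH _ sK')]; apply: leq_trans.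
rewrite addnS -addSn leq_add2r.
have [leK eK] := lS _ _ sK sK' KK'; rewrite ltn_neqAle leK andbT.
by apply/eqP => /eK.
Qed.

Lemma chainS M d (K U V : M -> Prop) : submod V -> chain d K U ->
  (forall x, U x -> V x) -> ~ (forall x, V x -> U x) -> chain d.+1 K V.
Proof.
move=> sV; elim: d K => [|d IH] K; last first.
  by case=> K' [sK' KK' nKK' /IH{}IH] UV nVU; exists K'; split=> //; apply: IH.
move=> KU UV nVU; exists V; split=> //; first by move=> x /KU/UV.
by move=> VK; apply: nVU => x /VK/KU.
Qed.

(** As [K] is the full preimage of [K'], the induced map from [A/K] to [B/K'] is injective. A chain
    of submodules [W] above [K] is sent to the chain of the [f(W) + K'], which stays strict and ends
    at [f(A) + K']. *)
Lemma chain_transport A B (f : {linear A -> B}) d (K' : B -> Prop) :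
  submod K' -> forall K : A -> Prop, submod K -> (forall x, K x <-> K' (f x)) ->
  chain d K (fun _ => True) ->
  chain d K' (fun y => exists u v, [/\ exists x, f x = u, K' v & y = u + v]).
Proof.
move=> sK' K sK KE ch.
pose T (W : A -> Prop) y := exists u v, [/\ exists x, W x /\ f x = u, K' v & y = u + v].
have main W : submod W -> (forall x, K x -> W x) -> chain d W (fun _ => True) ->
    chain d (T W) (T (fun _ => True)).
  elim: d W {ch} => [|d IH] W sW KW.
    by move=> _ _ [_ [v [[x [_ <-]] Kv ->]]]; exists (f x), v; split=> //; exists x.
  case=> W' [sW' WW' nWW' ch]; exists (T W'); split.
  - by apply: submod_add => //; apply: submod_image.
  - by move=> _ [_ [v [[x [/WW' Wx <-]] Kv ->]]]; exists (f x), v; split=> //; exists x.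
  - move=> TW; apply: nWW' => x W'x.
    have [_ [v [[y [Wy <-]] Kv e]]] : T W (f x).
      apply: TW; exists (f x), 0; rewrite addr0; split=> //; first by exists x.
      exact: submod0.
    rewrite -[x](subrK y); apply: submodD => //; apply/KW/KE.
    by rewrite linearB e addrC addKr.
  - by apply: IH ch => // x Kx; apply: WW'; apply: KW.
have toT y : K' y <-> T K y.
  split=> [K'y|[_ [v [[x [/KE Kx <-] Kv ->]]]]]; last exact: submodD.
  exists 0, y; rewrite add0r; split=> //; exists 0; rewrite linear0; split=> //; exact: submod0.
have -> : K' = T K by apply/funext => y; apply/propext/toT.
have -> // : (fun y => exists u v, [/\ exists x, f x = u, T K v & y = u + v]) = T (fun _ => True).
  apply/funext => y; apply/propext; split=> [[u [v [[x <-] /toT Kv ->]]]|].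
    by exists (f x), v; split=> //; exists x.
  by case=> _ [v [[x [_ <-]] /toT Kv ->]]; exists (f x), v; split=> //; exists x.
exact: main.
Qed.

Lemma chain_mono M d (K U V : M -> Prop) :
  (forall x, U x -> V x) -> chain d K U -> chain d K V.
Proof.
move=> UV; elim: d K => [|d IH] K /=; first by move=> KU x /KU/UV.
by case=> K' [sK' KK' nKK' /IH ch]; exists K'.
Qed.

Lemma length_le_inj A B (f : {linear A -> B}) L :
  injective f -> length_le B L -> length_le A L.
Proof.
move=> finj lB d K sK ch.
have sfK := submod_image f sK.
apply: (lB _ _ sfK); apply: chain_mono (chain_transport sfK sK _ ch) => // x.
by split=> [Kx|[y [Ky /finj <-]]//]; exists x.
Qed.

Lemma finite_length_row n : finite_length (R^o : lmodType R) ->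
  finite_length ('rV[R]_n : lmodType R).
Proof.
move=> flR; elim: n => [|n IH].
  by apply: finite_length_trivial => v; apply/rowP => -[].
(* The entry at [ord0] takes the default 0, so this map embeds the rows as the kernel of that
   coordinate. *)
have f_lin : linear (fun v : 'rV[R]_n => \row_i oapp (v 0) 0 (unlift ord0 i) : 'rV[R]_n.+1).
  move=> c u v; apply/rowP => i; rewrite !mxE; case: unlift => [j|] /=; rewrite ?mxE //.
  by rewrite mulr0 addr0.
have g_lin : linear (fun v : 'rV[R]_n.+1 => v 0 ord0 : R^o).
  by move=> c u v; rewrite !mxE.
apply: (finite_length_ext (f := mklin f_lin) (g := mklin g_lin)) => // v v0.
exists (\row_i v 0 (lift ord0 i)); apply/rowP => i; rewrite !mxE.
by case: unliftP => [j ->|->] /=; rewrite ?mxE.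
Qed.

Lemma finite_length_fp M : finite_length (R^o : lmodType R) ->
  finitely_presented M -> finite_length M.
Proof.
move=> flR [m [n [d [e [esurj _]]]]].
exact: finite_length_surj esurj (finite_length_row n flR).
Qed.

End FiniteLength.

(** * Annihilators and finite length of the ring *)

Section Annihilators.
Variable R : pzRingType.
Hypothesis injRc : injective_module ((R^c)^o : lmodType R^c).
Hypothesis artRc : artinian_module ((R^c)^o : lmodType R^c).

(** The right linear map sending [x] to [b x] kills the kernel of the one sending [x] to the row of
    the [a_i x]. Self-injectivity writes the first as a map [h] after the second; evaluation at 1
    gives the coefficients, the values of [h] at the unit rows. *)
Lemma annihilator_span n (a : 'I_n -> R) (b : R) :
  (forall x : R, (forall i, a i * x = 0) -> b * x = 0) ->
  exists c : 'I_n -> R, b = \sum_i c i * a i.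
Proof.
move=> ab.
have f_lin : linear (fun x : (R^c)^o => (\row_i (a i * (x : R)) : 'rV[R^c]_n)).
  by move=> c x y; apply/rowP => i; rewrite !mxE mulrDr mulrA.
have g_lin : linear (fun x : (R^c)^o => b * (x : R) : (R^c)^o).
  by move=> c x y; rewrite mulrDr mulrA.
have [|h hE] := @injective_module_ext R^c (R^c)^o (R^c)^o 'rV[R^c]_n
  (mklin f_lin) (mklin g_lin) injRc.
  move=> x /= /rowP ax; apply: ab => i; have := ax i; by rewrite !mxE.
(* Scaling over [R^c] is right multiplication in [R]. *)
have hZ (c : R^c) v : h (c *: v) = (h v : R) * (c : R) by rewrite linearZ.
exists (fun i => h (delta_mx 0 i)).
have := hE 1; rewrite !mklinE mulr1 => <-.
rewrite [X in h X](@row_sum_delta R^c) linear_sum; apply: eq_bigr => i _.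
by apply: etrans (hZ _ _) _; rewrite mxE mulr1.
Qed.

Definition right_annihilator (L : R^o -> Prop) (x : (R^c)^o) : Prop :=
  forall a, L a -> (a : R) * (x : R) = 0.

Lemma submod_right_annihilator L : submod (right_annihilator L).
Proof.
split=> [a La|c x y Lx Ly a La]; first by rewrite mulr0.
by rewrite mulrDr [(a : R) * _](mulrA (a : R) (x : R) (c : R)) Lx // mul0r add0r Ly.
Qed.

(* Enlarging a finitely generated left ideal shrinks its right annihilator, so
   the descending chain condition on the right bounds the number of generators. *)
Lemma left_ideal_fg (L : R^o -> Prop) : submod L ->
  exists n (a : 'I_n -> R), (forall i, L (a i)) /\
    forall b, L b -> exists c : 'I_n -> R, b = \sum_i c i * a i.
Proof.
move=> sL.
pose ann n (a : 'I_n -> R) (x : R) := forall i, a i * x = 0.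
pose Cl (N : (R^c)^o -> Prop) := exists n (a : 'I_n -> R),
  (forall i, L (a i)) /\ N = ann n a.
have [||N [[n [a [La ->]]] minN]] := artinian_min (Cl := Cl) artRc.
- move=> _ [n [a [_ ->]]]; split=> [i|c x y ax ay i]; first by rewrite mulr0.
  by rewrite mulrDr [a i * _](mulrA (a i) (x : R) (c : R)) ax mul0r add0r ay.
- by exists (ann 0%N (fun=> 0)), 0%N, (fun=> 0); split=> // -[].
exists n, a; split=> // b Lb; apply: annihilator_span => x ax.
pose a' (i : 'I_n.+1) := oapp a b (unlift ord0 i).
have : ann _ a' x.
  apply: minN ax => [|y a'y i].
    by exists n.+1, a'; split=> // i; rewrite /a'; case: unlift.
  by have := a'y (lift ord0 i); rewrite /a' liftK.
by move/(_ ord0); rewrite /a' unlift_none.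
Qed.

(** Since [L] is finitely generated, its right annihilator is that of finitely many generators, and
    [annihilator_span] applies to them. *)
Lemma double_annihilator (L : R^o -> Prop) (b : R) : submod L ->
  (forall x, right_annihilator L x -> b * (x : R) = 0) -> L b.
Proof.
move=> sL Lb; have [n [a [La aL]]] := left_ideal_fg sL.
have [|c ->] := @annihilator_span n a b.
  move=> x ax; apply: Lb => y /aL[c ->].
  by rewrite mulr_suml big1 // => i _; rewrite -mulrA ax mulr0.
exact: (submod_sum sL (F := fun i => c i *: (a i : R^o)) _ (fun i => submodZ sL (c i) (La i))).
Qed.

(** Among left ideals of finite length take [U] with minimal right annihilator. If [U] is proper,
    the descending chain condition on the left gives [V] minimal strictly above [U]; then [V/U] is
    simple and [V] has finite length too. Minimality gives [V] the same right annihilator as [U], so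
    [V] lies in [U] by the double annihilator property, a contradiction. *)
Lemma finite_length_regular : artinian_module (R^o : lmodType R) ->
  finite_length (R^o : lmodType R).
Proof.
move=> artR.
pose FL (U : R^o -> Prop) := exists sU : submod U, finite_length (sub_module sU).
pose Cl (N : (R^c)^o -> Prop) := exists U, FL U /\ N = right_annihilator U.
have [||_ [[U [[sU flU] ->]] minU]] := artinian_min (Cl := Cl) artRc.
- by move=> _ [U [_ ->]]; apply: submod_right_annihilator.
- have s0 := submod_zero (R^o : lmodType R).
  exists (right_annihilator (fun x => x = 0)), (fun x => x = 0); split=> //.
  exists s0; apply: finite_length_trivial => x; apply: (@sub_incl_inj _ _ _ s0).
  by rewrite linear0; exact: (sub_inclP x).
have [Utop|nUtop] := pselect (forall x, U x).
  apply: (finite_length_surj (g := sub_incl sU)) flU => x.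
  by apply: sub_incl_lift.
pose Cl' (V : R^o -> Prop) :=
  [/\ submod V, forall x, U x -> V x & ~ forall x, V x -> U x].
have [|| V [[sV UV nVU] minV]] := artinian_min (Cl := Cl') artR.
- by move=> V [].
- exists (fun=> True); split=> [|//|UT]; [exact: submod_full | by apply: nUtop => x; apply: UT].
case: nVU => x Vx; apply: double_annihilator => // y Uy.
suff /(_ y Uy) : forall y, right_annihilator U y -> right_annihilator V y by apply.
apply: (minU (right_annihilator V)) => [|z Vz a Ua]; last by apply: Vz; apply: UV.
exists V; split=> //; exists sV => {x y Vx Uy}.
have sUV := submod_preim (sub_incl sV) sU.
have [f fE] := sub_corestrict sV (f := sub_incl sU) (fun x => UV _ (sub_inclP x)).
apply: (finite_length_ext (f := f) (g := qproj sUV)) flU _.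
  move=> b /qproj_eq0 /(sub_incl_lift sU)[a ea]; exists a.
  by apply: (@sub_incl_inj _ _ _ sV); rewrite fE.
apply: finite_length_simple => W sW [w [Ww nw]] q.
have [v <-] := qproj_surj q.
pose V' x := exists y, W (qproj sUV y) /\ sub_incl sV y = x.
have sV' : submod V'.
  exact/submod_image/(submod_preim (qproj sUV)).
have [||y [Wy /sub_incl_inj <-] //] := minV V' _ _ (sub_incl sV v) (sub_inclP v).
- split=> //.
  + move=> x Ux; have [y ey] := sub_incl_lift sV (UV _ Ux); exists y; split=> //.
    suff -> : qproj sUV y = 0 by apply: submod0.
    by apply/qproj_eq0; rewrite ey.
  + move=> VU; have [y ey] := qproj_surj w; apply: nw; rewrite -ey.
    by apply/qproj_eq0; apply: VU; exists y; rewrite ey.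
- by move=> x [y [_ <-]]; apply: sub_inclP.
Qed.

End Annihilators.

(** * Indecomposable modules and the Harada-Sai argument *)

Section Indecomposables.
Variable R : pzRingType.
Implicit Types M A B C Z : lmodType R.

Lemma finite_length_min M (Cl : (M -> Prop) -> Prop) : finite_length M ->
  (forall N, Cl N -> submod N) -> (exists N, Cl N) ->
  exists N, Cl N /\ forall N', Cl N' -> (forall x, N' x -> N x) -> forall x, N x -> N' x.
Proof.
move=> [l lS _] sub [N0 CN0].
have ex : exists n, `[< exists N, Cl N /\ l N = n >] by exists (l N0); apply/asboolP; exists N0.
case: (ex_minnP ex) => n /asboolP[N [CN lN]] minn; exists N; split=> // N' CN' leN'.
have [le eq] := lS _ _ (sub _ CN') (sub _ CN) leN'.
apply: eq; apply/eqP; rewrite eqn_leq le lN; apply: minn; apply/asboolP; by exists N'.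
Qed.

Lemma indecomposable_internal M (U V : M -> Prop) : indecomposable M ->
  submod U -> submod V -> (forall x, U x -> V x -> x = 0) ->
  (forall x, exists u v, [/\ U u, V v & x = u + v]) ->
  (forall x, U x -> x = 0) \/ (forall x, V x -> x = 0).
Proof.
move=> [_ indM] sU sV UV0 UVM.
pose f := copair_lin (sub_incl sU) (sub_incl sV).
have fE u v : f (u, v) = sub_incl sU u + sub_incl sV v by [].
have finj : injective f.
  apply: linear_inj0 => -[u v]; rewrite fE => /eqP; rewrite addr_eq0 => /eqP e.
  have u0 : sub_incl sU u = 0.
    apply: UV0; first exact: sub_inclP.
    by rewrite e; apply: submodN => //; exact: sub_inclP.
  congr pair; first by apply: (@sub_incl_inj _ _ _ sU); rewrite u0 linear0.
  apply: (@sub_incl_inj _ _ _ sV); rewrite linear0.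
  by apply/eqP; rewrite -oppr_eq0 -e u0.
have [|g [fK gK]] := linear_bij_inv finj.
  move=> x; have [u [v [/(sub_incl_lift sU)[u' <-] /(sub_incl_lift sV)[v' <-] ->]]] := UVM x.
  by exists (u', v').
have [|U0|V0] := indM (sub_module sU) (sub_module sV); first by exists g; exists f.
  by left=> x /(sub_incl_lift sU)[u <-]; rewrite (U0 u) linear0.
by right=> x /(sub_incl_lift sV)[u <-]; rewrite (V0 u) linear0.
Qed.

Section HaradaSai.
Variables (A : nat -> lmodType R) (f : forall m, {linear A m -> A m.+1}).

Fixpoint dies_in k m : A m -> Prop :=
  if k is k'.+1 then fun x => dies_in k' (f m x) else fun x => x = 0.

(** The kernel of the canonical map from [A m] to the direct limit of the sequence. *)
Definition dies m (x : A m) : Prop := exists k, dies_in k x.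

Lemma dies_inS k m (x : A m) : dies_in k x -> dies_in k.+1 x.
Proof. by elim: k m x => [|k IH] m x /= => [->|/IH]; rewrite ?linear0. Qed.

Lemma dies_in_le j k m (x : A m) : (j <= k)%N -> dies_in j x -> dies_in k x.
Proof. by move=> /subnKC <-; rewrite addnC; elim: (k - j)%N => // i IH /IH/dies_inS. Qed.

Lemma submod_dies_in k m : submod (@dies_in k m).
Proof.
elim: k m => [|k IH] m; first exact: submod_zero.
exact: (submod_preim (f m) (IH m.+1)).
Qed.

Lemma submod_dies m : submod (@dies m).
Proof.
split=> [|c x y [j dx] [k dy]]; first by exists 0%N.
exists (maxn j k); apply: submodP; first exact: submod_dies_in.
  exact: dies_in_le (leq_maxl _ _) dx.
exact: dies_in_le (leq_maxr _ _) dy.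
Qed.

Lemma dies_step m (x : A m) : dies x <-> dies (f m x).
Proof. by split=> [[k /dies_inS]|[k dk]]; [exists k | exists k.+1]. Qed.

Fixpoint iterate_map k : {linear A 0%N -> A k} :=
  if k is k'.+1 then f k' \o iterate_map k' else idfun.

Lemma dies_iterate k (x : A 0%N) : dies (iterate_map k x) -> dies x.
Proof. by elim: k => // k IH dx; apply/IH/dies_step. Qed.

Lemma iterate_dies (x : A 0%N) : dies x -> exists n, iterate_map n x = 0.
Proof.
suff H k n : dies_in k (iterate_map n x) -> exists n, iterate_map n x = 0.
  by move=> [k]; apply: (H k 0%N).
by elim: k n => [|k IH] n dx; [exists n | apply: (IH n.+1)].
Qed.

Lemma iterate_kernel_le m n (x : A 0%N) : (m <= n)%N ->
  iterate_map m x = 0 -> iterate_map n x = 0.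
Proof.
move=> /subnKC <-; rewrite addnC; elim: (n - m)%N => //= i IH /IH ->; exact: linear0.
Qed.

(** The kernels in [A 0] of the iterated maps increase and become stationary at some [n]. From there
    on each module is the direct sum of the image of [A 0] and of its dying elements; the image
    contains the nonzero [y], so by indecomposability nothing dies. *)
Lemma indecomposable_limit (y : forall m, A m) :
  (forall m, indecomposable (A m)) -> finite_length (A 0%N) ->
  (forall m, y m.+1 = f m (y m)) -> (forall m, y m <> 0) ->
  (forall m (z : A m.+1), exists x k, dies k /\ z = f m x + k) ->
  exists m, bijective (f m).
Proof.
move=> indA [l lS [L lL]] yS y0 onto.
have sker n : submod (fun x => iterate_map n x = 0) by apply: submod_ker.
have ex : exists d, `[< exists n, l (fun x => iterate_map n x = 0) = d >].
  by exists (l (fun x => iterate_map 0 x = 0)); apply/asboolP; exists 0%N.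
have ub d : `[< exists n, l (fun x => iterate_map n x = 0) = d >] -> (d <= L)%N.
  by move=> /asboolP[n <-]; apply: lL.
case: (ex_maxnP ex ub) => _ /asboolP[n <-] maxl.
(* The kernel at [n] has maximal rank, so it contains all later kernels and hence every dying
   element. *)
have stable x : dies x -> iterate_map n x = 0.
  move=> /iterate_dies[p ep]; have le := leq_maxl n p.
  have [lle leq] := lS _ _ (sker n) (sker (maxn n p)) (fun x => iterate_kernel_le (x := x) le).
  apply: leq (iterate_kernel_le (leq_maxr n p) ep).
  by apply/eqP; rewrite eqn_leq lle; apply: maxl; apply/asboolP; exists (maxn n p).
have span k z : exists x d, dies d /\ z = iterate_map k x + d.
  elim: k z => [|k IH] z; first by exists z, 0; rewrite addr0; split=> //; exists 0%N.
  have [x [d [dd ->]]] := onto k z; have [x' [d' [dd' ->]]] := IH x.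
  exists x', (f k d' + d); rewrite linearD addrA; split=> //.
  by apply: (submodD (submod_dies _)) => //; apply: (dies_step _).1.
have yE m : y m = iterate_map m (y 0%N) by elim: m => //= m <-.
have alive m : ~ dies (y m).
  move=> [k]; elim: k m => [|k IH] m; first exact: y0.
  by rewrite /= -yS; apply: IH.
have dies0 m (z : A (m + n)%N) : dies z -> z = 0.
  have [] := indecomposable_internal (indA (m + n)%N) (submod_range (iterate_map (m + n)))
    (@submod_dies (m + n)%N).
  - move=> _ [x <-] /dies_iterate/stable; apply: iterate_kernel_le; exact: leq_addl.
  - move=> z'; have [x [d [dd ->]]] := span _ z'.
    by exists (iterate_map (m + n) x), d; split=> //; exists x.
  - by move=> I0; case: (alive (m + n)%N); exists 0%N; apply: I0; exists (y 0%N); rewrite [RHS]yE.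
  - by move=> K0 /K0.
exists n; have [|z|g [fK gK]] := @linear_bij_inv R _ _ (f n); last by exists g.
  by apply: linear_inj0 => x fx0; apply: (dies0 0%N); exists 1%N.
have [x [d [/(dies0 1%N) -> ->]]] := onto n z; by exists x; rewrite addr0.
Qed.

End HaradaSai.

(* A form of the Harada-Sai lemma.  Modulo the elements that eventually die the
   maps are injective, so by bounded length they are eventually surjective; then
   A_m is the direct sum of the dying elements and of the image of an earlier
   module, so nothing dies and the maps are eventually bijective. *)
Lemma harada_sai (A : nat -> lmodType R) (f : forall m, {linear A m -> A m.+1})
    (y : forall m, A m) L :
  (forall m, indecomposable (A m)) -> (forall m, finite_length (A m)) ->
  (forall m, length_le (A m) L) ->
  (forall m, y m.+1 = f m (y m)) -> (forall m, y m <> 0) ->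
  exists m, bijective (f m).
Proof.
move=> indA flA lenA yS y0.
have ex : exists d, `[< exists m, chain d (@dies A f m) (fun=> True) >].
  by exists 0%N; apply/asboolP; exists 0%N.
have ub d : `[< exists m, chain d (@dies A f m) (fun=> True) >] -> (d <= L)%N.
  by move=> /asboolP[m ch]; apply: lenA (submod_dies f m) ch.
(* [d] is the greatest length of a chain above the dying elements, over all [m]; transport keeps it
   attained after [m0]. *)
case: (ex_maxnP ex ub) => d /asboolP[m0 ch0] maxd.
pose T m (z : A m.+1) := exists u v, [/\ exists x, f m x = u, dies f v & z = u + v].
have chT m : chain d (@dies A f m) (fun=> True) -> chain d (@dies A f m.+1) (@T m).
  exact: (chain_transport (submod_dies f m.+1) (submod_dies f m) (dies_step f (m := m))).
have ch m : chain d (@dies A f (m + m0)) (fun=> True).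
  by elim: m => // m /chT; apply: chain_mono.
(* An element outside the transported chain's last term would allow one more strict step, against
   the choice of [d]. *)
have onto m z : T (m + m0)%N z.
  apply: contrapT => nTz.
  have : chain d.+1 (@dies A f (m.+1 + m0)) (fun=> True).
    by apply: chainS (chT _ (ch m)) _ _ => // TT; apply/nTz/TT.
  move=> ch'; suff : (d.+1 <= d)%N by rewrite ltnn.
  by apply: maxd; apply/asboolP; exists (m.+1 + m0)%N.
pose A' m := A (m + m0)%N; pose f' m : {linear A' m -> A' m.+1} := f (m + m0)%N.
have [m bij] : exists m, bijective (f' m); last by exists (m + m0)%N.
apply: (@indecomposable_limit A' f' (fun m => y (m + m0)%N)).
- by move=> m; apply: indA.
- exact: flA.
- by move=> m; apply: yS.
- by move=> m; apply: y0.
move=> m z; have [_ [v [[x <-] [k dk] ->]]] := onto m z; exists x, v; split=> //.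
(* Dying in the original sequence has to be matched with dying in the sequence shifted by [m0]. *)
exists k; move: dk; rewrite /A'.
suff H p (w : A (p + m0)%N) : dies_in f k w -> @dies_in A' f' k p w by apply: (H m.+1).
by elim: k p w => //= k IH p w /(IH p.+1).
Qed.

End Indecomposables.

(** * Finitely presented modules and their direct summands *)

Section FinitelyPresented.
Variable R : pzRingType.
Implicit Types M A B C Z : lmodType R.

Lemma row_lift A B (p : {linear A -> B}) n (f : {linear 'rV[R]_n -> B}) :
  (forall b, exists a, p a = b) -> exists g : {linear 'rV[R]_n -> A}, forall v, p (g v) = f v.
Proof.
move=> psurj; pose y i := sval (cid (psurj (f (delta_mx 0 i)))).
exists (row_lin y) => v; suff -> : f = p \o row_lin y by [].
by apply: row_lin_ext => i; rewrite /= row_lin_delta; rewrite (svalP (cid (psurj _))).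
Qed.

Section Blocks.
Variables (m n : nat).
Fact lsub_lin_linear : linear (fun v : 'rV[R]_(m + n) => lsubmx v).
Proof. by move=> c u v; apply/rowP => i; rewrite !mxE. Qed.
Definition lsub_lin : {linear 'rV[R]_(m + n) -> 'rV[R]_m} := mklin lsub_lin_linear.
Fact rsub_lin_linear : linear (fun v : 'rV[R]_(m + n) => rsubmx v).
Proof. by move=> c u v; apply/rowP => i; rewrite !mxE. Qed.
Definition rsub_lin : {linear 'rV[R]_(m + n) -> 'rV[R]_n} := mklin rsub_lin_linear.
Fact row_mx_lin_linear :
  linear (fun u : ('rV[R]_m * 'rV[R]_n)%type => row_mx u.1 u.2).
Proof.
move=> c u v; apply/rowP => i; rewrite !mxE.
by case: splitP => j _; rewrite !mxE.
Qed.
Definition row_mx_lin : {linear ('rV[R]_m * 'rV[R]_n)%type -> 'rV[R]_(m + n)} :=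
  mklin row_mx_lin_linear.
End Blocks.

Lemma fp_row n : finitely_presented ('rV[R]_n : lmodType R).
Proof.
exists 0%N, n, \0, idfun; split=> [x|v]; first by exists x.
by split=> [/= ->|[w <-]] //; exists 0.
Qed.

Lemma fp_generated M : finitely_presented M ->
  exists n (e : {linear 'rV[R]_n -> M}), forall x, exists v, e v = x.
Proof. by case=> [m [n [d [e [esurj _]]]]]; exists n, e. Qed.

Lemma fp_prod A B : finitely_presented A -> finitely_presented B ->
  finitely_presented (A * B)%type.
Proof.
move=> [m [n [d [e [esurj ekerP]]]]] [m' [n' [d' [e' [e'surj e'kerP]]]]].
pose ee : {linear _ -> (A * B)%type} :=
  pair_lin (e \o lsub_lin n n') (e' \o rsub_lin n n').
pose dd : {linear _ -> _} :=
  row_mx_lin n n' \o pair_lin (d \o lsub_lin m m') (d' \o rsub_lin m m').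
have eeE v : ee v = (e (lsubmx v), e' (rsubmx v)) by [].
have ddE w : dd w = row_mx (d (lsubmx w)) (d' (rsubmx w)) by [].
exists (m + m')%N, (n + n')%N, dd, ee; split=> [[x y]|v].
  have [u eu] := esurj x; have [v ev] := e'surj y.
  by exists (row_mx u v); rewrite eeE row_mxKl row_mxKr eu ev.
rewrite eeE; split=> [[/ekerP[u eu] /e'kerP[w ew]]|[w <-]].
  by exists (row_mx u w); rewrite ddE row_mxKl row_mxKr eu ew hsubmxK.
rewrite ddE row_mxKl row_mxKr.
congr pair; [apply/ekerP | apply/e'kerP]; by eexists.
Qed.

(** The relations of [A] are those of [B] together with lifts of the generators of the kernel of
    [p]. *)
Lemma fp_quotient B A (p : {linear B -> A}) m (j : {linear 'rV[R]_m -> B}) :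
  finitely_presented B -> (forall a, exists b, p b = a) ->
  (forall b, p b = 0 <-> exists w, j w = b) -> finitely_presented A.
Proof.
move=> [m' [n [d [e [esurj ekerP]]]]] psurj pkerP.
have [j' j'E] := row_lift j esurj.
have [dd ddE] : exists dd : {linear 'rV[R]_(m' + m) -> 'rV[R]_n},
    forall v, dd v = d (lsubmx v) + j' (rsubmx v).
  by exists (copair_lin d j' \o pair_lin (lsub_lin m' m) (rsub_lin m' m)).
exists (m' + m)%N, n, dd, (p \o e); split.
  by move=> a; have [b <-] := psurj a; have [v <-] := esurj b; exists v.
move=> v /=; split=> [/pkerP[w ew]|[w <-]].
  have [|u eu] := (ekerP (v - j' w)).1; first by rewrite linearB j'E ew subrr.
  by exists (row_mx u w); rewrite ddE row_mxKl row_mxKr eu subrK.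
rewrite ddE !linearD j'E.
have -> : e (d (lsubmx w)) = 0 by apply/ekerP; eexists.
by rewrite linear0 add0r; apply/pkerP; eexists.
Qed.

(** The kernel of [p] is the range of the complementary idempotent [1 - i p], hence finitely
    generated. *)
Lemma fp_retract A B (i : {linear A -> B}) (p : {linear B -> A}) :
  finitely_presented B -> cancel i p -> finitely_presented A.
Proof.
move=> fpB iK; have [n [e esurj]] := fp_generated fpB.
have [r rE] : exists r : {linear B -> B}, forall x, r x = x - i (p x).
  by exists ((idfun : {linear B -> B}) - (i \o p : {linear B -> B})).
apply: (fp_quotient (p := p) (j := r \o e)) => // [a|b]; first by exists (i a).
split=> [pb|[w <-]]; last by rewrite /= rE linearB /= iK subrr.
by have [v ev] := esurj b; exists v; rewrite /= rE ev pb linear0 subr0.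
Qed.

Lemma fp_regular : finitely_presented (R^o : lmodType R).
Proof.
have i_lin : linear (fun x : R^o => const_mx x : 'rV[R]_1).
  by move=> c x y; apply/rowP => k; rewrite !mxE.
have p_lin : linear (fun v : 'rV[R]_1 => v 0 0 : R^o) by move=> c x y; rewrite !mxE.
apply: (fp_retract (i := mklin i_lin) (p := mklin p_lin) (fp_row 1)) => x.
by rewrite !mklinE mxE.
Qed.

(** Take an idempotent [e] of minimal range among those with [g (e b)] nonzero. A decomposition of
    the range gives two complementary idempotents; [g] stays nonzero on one of the two components of
    [e b], and by minimality that idempotent is the identity. *)
Lemma indecomposable_summand B Z (g : {linear B -> Z}) b :
  finite_length B -> finitely_presented B -> g b <> 0 ->
  exists A (i : {linear A -> B}) (p : {linear B -> A}),
    [/\ finitely_presented A, indecomposable A, cancel i p & g (i (p b)) <> 0].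
Proof.
move=> flB fpB gb.
pose Cl N := exists e : {linear B -> B},
  [/\ forall x, e (e x) = e x, g (e b) <> 0 & N = fun y => exists x, e x = y].
have [||_ [[e [ee geb ->]] min_e]] := finite_length_min (Cl := Cl) flB.
- by move=> _ [e [_ _ ->]]; apply: submod_range.
- by exists (fun y => exists x, (idfun : {linear B -> B}) x = y), idfun.
have sI := submod_range e.
have [p pE] := sub_corestrict sI (f := e) (fun x => ex_intro _ x erefl).
pose i := sub_incl sI.
have iK : cancel i p.
  move=> a; apply: (@sub_incl_inj _ _ _ sI); rewrite pE.
  by have [x ex] := sub_inclP a; rewrite -ex ee.
exists (sub_module sI), i, p; split; [exact: fp_retract iK | split | exact: iK | by rewrite pE].
  by move=> A0; apply: geb; rewrite -pE (A0 (p b)) !linear0.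
(* By minimality the idempotent [i q p] has the same range as [e], so [q] is onto; being idempotent,
   it is the identity. *)
have triv (q : {linear sub_module sI -> sub_module sI}) :
    (forall x, q (q x) = q x) -> g (i (q (p b))) <> 0 -> forall a, q a = a.
  move=> qq gq a; pose e' : {linear B -> B} := i \o q \o p.
  have [|||x ex] := min_e (fun y => exists x, e' x = y) _ _ (i a); last first.
  - suff -> : a = q (p x) by rewrite qq.
    by apply: (@sub_incl_inj _ _ _ sI); rewrite -[LHS]ex.
  - exact: (sub_inclP a).
  - by move=> _ [x <-]; exists (i (q (p x))); rewrite -pE iK.
  - by exists e'; split=> // x; rewrite /e' /= !iK qq.
move=> A1 A2 [h [k0 hK0 kK0]].
have [|z|k [hK kK]] := @linear_bij_inv R _ _ h; [exact: can_inj hK0 | by exists (k0 z) |].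
pose q1 : {linear sub_module sI -> sub_module sI} := k \o pair_lin (fst_lin A1 A2) \0 \o h.
pose q2 : {linear sub_module sI -> sub_module sI} := k \o pair_lin \0 (snd_lin A1 A2) \o h.
have q1E x : q1 x = k ((h x).1, 0) by [].
have q2E x : q2 x = k (0, (h x).2) by [].
have [gq1|gq1] := pselect (g (i (q1 (p b))) = 0); last first.
  right=> y; have : q1 (k (0, y)) = k (0, y).
    by apply: triv gq1 _ => x; rewrite !q1E kK.
  by rewrite q1E kK => /(congr1 h); rewrite !kK => -[].
left=> y; have : q2 (k (y, 0)) = k (y, 0); last first.
  by rewrite q2E kK => /(congr1 h); rewrite !kK => -[].
apply: triv => [x|gq2]; first by rewrite !q2E kK.
apply: geb; rewrite -pE -/i -[p b]hK.
have -> : h (p b) = ((h (p b)).1, 0) + (0, (h (p b)).2).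
  by case: (h _) => u v; congr pair; rewrite ?addr0 ?add0r.
by rewrite !linearD -q1E -q2E gq1 gq2 addr0.
Qed.

End FinitelyPresented.

(** * Pure maps and pure indecomposable submodules *)

Section PureMaps.
Variable R : pzRingType.
Implicit Types A B C Z : lmodType R.

(** Purity by linear systems: a finite system with coefficients [d] and constants in [A] that is
    solvable in [Z] is solvable in [A]. *)
Definition pure_map A Z (psi : {linear A -> Z}) : Prop :=
  forall m n (d : {linear 'rV[R]_m -> 'rV[R]_n}) (v : {linear 'rV[R]_n -> Z})
    (a : {linear 'rV[R]_m -> A}), (forall w, v (d w) = psi (a w)) ->
  exists r : {linear 'rV[R]_n -> A}, forall w, r (d w) = a w.

(** Purity is applied to the equation [x = 0], a system of one equation in no unknowns. *)
Lemma pure_map_inj A Z (psi : {linear A -> Z}) : pure_map psi -> injective psi.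
Proof.
move=> pure; apply: linear_inj0 => x psi0.
have e : psi \o row_lin (fun _ : 'I_1 => x) = \0 :> {linear _ -> _}.
  by apply: row_lin_ext => i; rewrite /= row_lin_delta.
have [|r rE] := pure 1%N 0%N \0 \0 (row_lin (fun=> x)).
  by move=> w; have /(congr1 (fun h : {linear 'rV[R]_1 -> Z} => h w)) := e.
have := rE (delta_mx 0 0); rewrite row_lin_delta => <-.
by rewrite /= linear0.
Qed.

(** For a system given by [d] and [a], let [B] be the pushout of [a] and [d]. A solution in [Z]
    factors [psi] through [B], and a retraction of [A -> B] is a solution in [A]. *)
Lemma non_pure_factor A Z (psi : {linear A -> Z}) : finitely_presented A ->
  ~ pure_map psi -> exists B (f : {linear A -> B}) (g : {linear B -> Z}),
    [/\ finitely_presented B, forall x, g (f x) = psi x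
      & forall r : {linear B -> A}, ~ forall x, r (f x) = x].
Proof.
move=> fpA npure; apply: contrapT => nofac; apply: npure => m n d v a va.
pose j := pair_lin a (\- d).
have jE w : j w = (a w, - d w) by [].
have sJ := submod_range j.
pose B := quot_module sJ; pose q := qproj sJ.
pose f : {linear A -> B} := q \o pair_lin idfun \0.
have fE x : f x = q (x, 0) by [].
have [|g gE] := linear_factor_surj (p := q) (f := copair_lin psi v) (@qproj_surj _ _ _ sJ).
  move=> x /qproj_eq0[w <-]; rewrite jE copair_linE /= linearN va.
  exact: subrr.
have gfE x : g (f x) = psi x by rewrite fE gE copair_linE /= linear0 addr0.
have fpB : finitely_presented B.
  apply: (fp_quotient (p := q) (j := j)) => [|b|b]; first exact: fp_prod fpA (fp_row _ _).
    exact: qproj_surj.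
  exact: qproj_eq0.
have [r rK] : exists r : {linear B -> A}, forall x, r (f x) = x.
  by apply: contrapT => nor; apply: nofac; exists B, f, g; split=> // r rK; apply: nor; exists r.
exists (r \o q \o pair_lin \0 idfun) => w /=.
rewrite -[RHS]rK; congr (r _); rewrite fE -/q; apply/eqP; rewrite eq_sym -subr_eq0 -linearB.
apply/eqP/qproj_eq0; exists w; rewrite jE.
by congr pair; rewrite /= ?subr0 ?sub0r.
Qed.

(** The states of the dependent choice in the next lemma; the point witnesses that the composites of
    the chain do not vanish. *)
Record pointed_test Z := PointedTest {
  pt_mod : lmodType R;
  pt_map : {linear pt_mod -> Z};
  pt_elt : pt_mod;
  _ : [/\ finitely_presented pt_mod, indecomposable pt_mod & pt_map pt_elt <> 0] }.

(** If a test [A -> Z] is not pure, it factors through a non-split [A -> B], and [B] has an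
    indecomposable summand [A'] on which the point survives in [Z]. The map [A -> A'] is not
    bijective, since its inverse would split [A -> B]. Iteration contradicts [harada_sai]. *)
Lemma pure_indecomposable Z L : finite_length (R^o : lmodType R) ->
  (forall A, finitely_presented A -> indecomposable A -> length_le A L) ->
  ~ module_zero Z ->
  exists A (psi : {linear A -> Z}), [/\ finitely_presented A, indecomposable A & pure_map psi].
Proof.
move=> flR lenL Z0; apply: contrapT => nopure.
have start : exists s : pointed_test Z, True.
  have [z nz] : exists z : Z, z <> 0.
    by apply: contrapT => nz; apply: Z0 => z; apply: contrapT => z0; apply: nz; exists z.
  have [|A [i [p [fpA indA _ nz']]]] := @indecomposable_summand R _ Z (row_lin (fun=> z))
    (delta_mx 0 0) (finite_length_row 1 flR) (fp_row R 1).
    by rewrite row_lin_delta.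
  by exists (@PointedTest Z A (row_lin (fun=> z) \o i) _ (And3 fpA indA nz')).
have next (s : pointed_test Z) : exists s' : pointed_test Z,
    exists2 f : {linear pt_mod s -> pt_mod s'}, ~ bijective f & pt_elt s' = f (pt_elt s).
  case: s => A g x [fpA indA gx] /=.
  have npure : ~ pure_map g by move=> pure; apply: nopure; exists A, g.
  have [B [f [g' [fpB gf nsplit]]]] := non_pure_factor fpA npure.
  have [|A' [i [p [fpA' indA' iK nz']]]] := @indecomposable_summand R B Z g' (f x)
    (finite_length_fp flR fpB) fpB; first by rewrite gf.
  exists (@PointedTest Z A' (g' \o i) (p (f x)) (And3 fpA' indA' nz')) => /=.
  exists (p \o f) => // -[k fK kK].
  have [|b|k' [k'K _]] := @linear_bij_inv R A A' (p \o f); first exact: can_inj fK.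
    by exists (k b).
  by apply: (nsplit (k' \o p)) => y; exact: k'K.
have [s0 _] := start.
pose step s := sval (cid (next s)); pose s n := iter n step s0.
have stepP n := cid2 (svalP (cid (next (s n)))).
pose f n : {linear pt_mod (s n) -> pt_mod (s n.+1)} := s2val (stepP n).
have [||||n|n bij] := @harada_sai R (fun n => pt_mod (s n)) f (fun n => pt_elt (s n)) L.
- by move=> n; case: (s n) => A g x [].
- by move=> n; case: (s n) => A g x [/= fpA _ _]; apply: finite_length_fp.
- by move=> n; case: (s n) => A g x [/= fpA indA _]; apply: lenL.
- by move=> n; rewrite (s2valP' (stepP n)).
- case: (s n) => A g x [/= _ _ gx] x0; apply: gx; by rewrite x0 linear0.
by apply: (s2valP (stepP n)).
Qed.

End PureMaps.

(** * From lifting on finitely presented modules to lifting on all modules *)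

Lemma row_in_submod (R : pzRingType) (M : lmodType R) n (f : {linear 'rV[R]_n -> M})
    (N : M -> Prop) : submod N -> (forall i, N (f (delta_mx 0 i))) -> forall x, N (f x).
Proof.
move=> sN Nf x; rewrite [x]row_sum_delta linear_sum; apply: submod_sum => // i.
by rewrite linearZ_LR; apply: submodZ.
Qed.

Section LocalLifting.
Local Open Scope classical_set_scope.
Local Open Scope ring_scope.
Variables (R : pzRingType) (L : nat).
Hypothesis flR : finite_length (R^o : lmodType R).
Hypothesis lenL : forall A : lmodType R,
  finitely_presented A -> indecomposable A -> length_le A L.

Variables Y W : lmodType R.
Variable Phi : forall C : lmodType R, finitely_presented C ->
  {linear C -> Y} -> {linear C -> W} -> Prop.
Hypothesis Phi_total : forall (C : lmodType R) (fC : finitely_presented C) h, exists k, @Phi C fC h k.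
Hypothesis Phi_comp : forall (C D : lmodType R) fC fD (u : {linear D -> C}) h k,
  @Phi C fC h k -> @Phi D fD (h \o u) (k \o u).
Hypothesis PhiB : forall (C : lmodType R) (fC : finitely_presented C) h h' k k',
  @Phi C fC h k -> Phi fC h' k' -> Phi fC (h - h') (k - k').

Let Phi0 (C : lmodType R) (fC : finitely_presented C) : Phi fC 0 0.
Proof. by have [k kP] := Phi_total fC 0; have := PhiB kP kP; rewrite !subrr. Qed.

Let PhiD (C : lmodType R) (fC : finitely_presented C) h h' k k' :
  Phi fC h k -> Phi fC h' k' -> Phi fC (h + h') (k + k').
Proof.
move=> Phk Phk'; rewrite -[h']opprK -[k']opprK; apply: PhiB => //.
by rewrite -[- h']add0r -[- k']add0r; apply: PhiB => //; apply: Phi0.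
Qed.

(* The graph of a partial solution with pure domain. *)
Record good (G : (Y * W)%type -> Prop) : Prop := Good {
  good_submod : submod G;
  good_fun : forall w, G (0, w) -> w = 0;
  good_pure : forall m n (d : {linear 'rV[R]_m -> 'rV[R]_n}) (v : {linear 'rV[R]_n -> Y}),
    (forall x, exists w, G (v (d x), w)) ->
    exists v' : {linear 'rV[R]_n -> Y},
      (forall x, exists w, G (v' x, w)) /\ forall x, v' (d x) = v (d x);
  good_Phi : forall (C : lmodType R) (fC : finitely_presented C) (hk : {linear C -> (Y * W)%type}),
    (forall c, G (hk c)) -> Phi fC (fst_lin Y W \o hk) (snd_lin Y W \o hk) }.

Let dom_submod (G : (Y * W)%type -> Prop) : submod G -> submod (fun y => exists w, G (y, w)).
Proof.
move=> sG; split=> [|c x y [w Gw] [w' Gw']]; first by exists 0; apply: (submod0 sG).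
by exists (c *: w + w'); apply: (submodP sG c Gw Gw').
Qed.

(** Let [N] be the domain of [G]. A pure finitely presented indecomposable [A] in [Y/N] lifts to
    [s : A -> Y] because [N] is pure; the domain grows to the direct sum of [N] and [s(A)], with any
    admissible [k] as the value on [s]. *)
Lemma good_extend G y0 : good G -> (forall w, ~ G (y0, w)) ->
  exists G', [/\ good G', forall z, G z -> G' z & ~ forall z, G' z -> G z].
Proof.
move=> gG ny0; have sG := good_submod gG.
have sN := dom_submod sG; pose q := qproj sN.
have qN y : q y = 0 <-> exists w, G (y, w) by apply: qproj_eq0.
have [|A [psi [fpA indA pure]]] := @pure_indecomposable R (quot_module sN) L flR lenL.
  by move=> /(_ (q y0))/qN[w /ny0].
have psi_inj := pure_map_inj pure.
have [m [n [d [e [esurj ekerP]]]]] := fpA.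
have [v vE] := row_lift (psi \o e) (@qproj_surj _ _ _ sN).
(* [v] lifts [psi] on generators only. Purity of the domain gives [v'] inside it that agrees with
   [v] on the relations, so [v - v'] descends to [A]. *)
have [|v' [v'N v'd]] := good_pure gG (d := d) (v := v).
  move=> x; apply/qN; rewrite /q vE /=.
  by have -> : e (d x) = 0 by [apply/ekerP; exists x]; rewrite linear0.
have [|s sE] := linear_factor_surj (p := e) (f := v - v' : {linear _ -> _}) esurj.
  by move=> _ /ekerP[w <-]; rewrite lin_subE v'd subrr.
have qs a : q (s a) = psi a.
  have [x <-] := esurj a; rewrite sE lin_subE linearB /q vE /=.
  by have -> : q (v' x) = 0 by [apply/qN]; rewrite subr0.
have [k sk] := Phi_total fpA s.
pose G' z := exists u t, [/\ G u, exists a, pair_lin s k a = t & z = u + t].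
have G'P z : G' z -> exists u a, G u /\ z = (u.1 + s a, u.2 + k a).
  by case=> u [_ [Gu [a <-] ->]]; exists u, a; case: u Gu.
have qG' u a : G u -> q (u.1 + s a) = psi a.
  move=> Gu; rewrite linearD qs; have -> : q u.1 = 0; last by rewrite add0r.
  by apply/qN; exists u.2; case: u Gu.
exists G'; split; first split.
- by apply: submod_add => //; apply: submod_range.
- move=> w /G'P[u [a [Gu [eu ->]]]].
  have a0 : a = 0.
    by apply: psi_inj; rewrite -(qG' u) // -eu !linear0.
  move: eu; rewrite a0 !linear0 !addr0 => eu; apply: (good_fun gG).
  by rewrite eu; case: u Gu {eu}.
(* Purity of the new domain: solve the system first in [A], modulo the old domain, then correct the
   remainder within the old domain. *)
- move=> m0 n0 d0 v0 v0d0.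
  have [|x|a|a [aE _]] := @linear_of_graph R 'rV[R]_m0 A (fun x a => q (v0 (d0 x)) = psi a).
  + by move=> c x y u t; rewrite !linearP => -> ->.
  + by have [w /G'P[u [a [Gu [-> _]]]]] := v0d0 x; exists a; apply: qG'.
  + by rewrite !linear0 -(linear0 psi) => /psi_inj.
  have [|r rE] := pure _ _ d0 (q \o v0) a; first exact: aE.
  have [|v1 [v1N v1d]] := good_pure gG (d := d0) (v := v0 - (s \o r : {linear _ -> _})).
    by move=> x; apply/qN; rewrite lin_subE linearB /= qs aE rE subrr.
  exists (v1 + (s \o r : {linear _ -> _})); split=> x; last first.
    by rewrite lin_addE v1d lin_subE subrK.
  have [w Gw] := v1N x; exists (w + k (r x)).
  by exists (v1 x, w), (s (r x), k (r x)); split=> //; exists (r x).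
(* A map into the new graph is the sum of a map into [G] and of [(s a, k a)], where [a] is its
   component in [A]. *)
- move=> C fC hk hkG'.
  have [|c|a|a [aE _]] := @linear_of_graph R C A (fun c a => q (hk c).1 = psi a).
  + by move=> c x y u t; rewrite !linearP => <- <-.
  + by have /G'P[u [a [Gu ->]]] := hkG' c; exists a; apply: qG'.
  + by rewrite !linear0 -(linear0 psi) => /psi_inj.
  have [hk' hk'E] : exists hk' : {linear C -> (Y * W)%type},
      forall c, hk' c = hk c - (s (a c), k (a c)).
    by exists (hk - (pair_lin s k \o a : {linear _ -> _})).
  have hk'G c : G (hk' c).
    rewrite hk'E; have := aE c.
    have /G'P[u [b [Gu ->]]] := hkG' c; rewrite qG' // => /psi_inj <-.
    by rewrite [X in G X](_ : _ = u) //; case: u Gu => x y _; congr pair; apply: addrK.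
  have := PhiD (good_Phi gG fC hk'G) (Phi_comp fC a sk).
  set h1 := (X in Phi fC X _ -> _); set k1 := (X in Phi fC _ X -> _).
  rewrite (_ : h1 = fst_lin Y W \o hk); last first.
    by apply: linear_ext => c; rewrite lin_addE /= hk'E; exact: subrK.
  rewrite (_ : k1 = snd_lin Y W \o hk) //.
  by apply: linear_ext => c; rewrite lin_addE /= hk'E; exact: subrK.
- by move=> z Gz; exists z, 0; rewrite addr0; split=> //; exists 0; rewrite linear0.
move=> G'G; case: indA => A0 _; apply: A0 => a; apply: psi_inj.
rewrite -qs linear0; apply/qN; exists (k a); apply: G'G.
by exists 0, (s a, k a); rewrite add0r; split=> //; [apply: (submod0 sG) | exists a].
Qed.

(** Zorn's lemma is applied to sets, including the union of the empty chain; adjoining 0 turns the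
    empty set into the zero graph. *)
Let hat (X : set (Y * W)%type) z := z = 0 \/ X z.

Let hatD (F : set (set (Y * W)%type)) n (z : 'I_n -> (Y * W)%type) :
  total_on F subset -> (forall i, hat (\bigcup_(X in F) X) (z i)) ->
  exists X, (X = set0 \/ F X) /\ forall i, hat X (z i).
Proof.
move=> Ftot Fz.
suff H p : exists X, (X = set0 \/ F X) /\ forall i : 'I_n, (i < p)%N -> hat X (z i).
  by have [X [FX Xz]] := H n; exists X; split=> // i; apply: Xz.
elim: p => [|p [X [FX Xz]]]; first by exists set0; split; [left|].
have [np|pn] := leqP n p.
  by exists X; split=> // i _; apply: Xz; apply: leq_trans np.
have [X' [FX' X'z]] : exists X', (X' = set0 \/ F X') /\ hat X' (z (Ordinal pn)).
  by case: (Fz (Ordinal pn)) => [->|[X' FX' X'z]]; [exists set0|exists X'];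
    split; [left|left|right|right].
have [X'' [FX'' XX'' X'X'']] : exists X'', [/\ X'' = set0 \/ F X'', X `<=` X'' & X' `<=` X''].
  case: FX => [->|FX]; first by exists X'; split=> // t [].
  case: FX' => [->|FX']; first by exists X; split=> [|t|t []] //; right.
  by case: (Ftot _ _ FX FX') => le; [exists X'|exists X]; split=> //; by right.
exists X''; split=> // i; rewrite ltnS leq_eqVlt => /orP[/eqP ip|/Xz[->|/XX'']].
- have -> : i = Ordinal pn by apply: val_inj.
  by case: X'z => [->|/X'X'']; [left|right].
- by left.
- by right.
Qed.

Lemma good_zero : good (fun z => z = 0).
Proof.
split=> [|w [->] //|m n d v v0|C fC hk hk0]; first exact: submod_zero.
  exists \0; split=> x; first by exists 0.
  by have [w [-> _]] := v0 x.
rewrite (_ : (fst_lin _ _ \o hk : {linear C -> Y}) = 0); last first.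
  by apply: linear_ext => c; rewrite /= hk0.
rewrite (_ : (snd_lin _ _ \o hk : {linear C -> W}) = 0); last first.
  by apply: linear_ext => c; rewrite /= hk0.
exact: Phi0.
Qed.

(** Each clause of [good] can be tested on finitely many elements, such as the images of generators,
    and by [hatD] these lie in one member of the chain. *)
Lemma good_chain (F : set (set (Y * W)%type)) :
  F `<=` [set X | good (hat X)] -> total_on F subset -> good (hat (\bigcup_(X in F) X)).
Proof.
move=> Fgood Ftot; set U := \bigcup_(X in F) X.
have hatU X z : X = set0 \/ F X -> hat X z -> hat U z.
  by case=> [->|FX] [->|] //; [left|left|right; exists X].
have gX X : X = set0 \/ F X -> good (hat X).
  case=> [->|/Fgood //]; rewrite (_ : hat set0 = fun z => z = 0); first exact: good_zero.
  by apply/funext => z; apply/propext; split=> [[]|] //; left.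
split.
- split=> [|c x y Ux Uy]; first by left.
  have [i|X [FX Xxy]] := @hatD F 2 (fun i => if i == ord0 then x else y) Ftot.
    by case: (i == ord0).
  apply: (hatU X) => //; apply: (submodP (good_submod (gX _ FX))).
    exact: (Xxy ord0).
  exact: (Xxy (lift ord0 ord0)).
- move=> w [[]//|[X FX Xw]]; apply: (good_fun (gX X (or_intror FX))); by right.
- move=> m n d v vU.
  pose w i := sval (cid (vU (delta_mx 0 i))).
  have [i|X [FX Xw]] := @hatD F m (fun i => (v (d (delta_mx 0 i)), w i)) Ftot.
    exact: svalP (cid (vU (delta_mx 0 i))).
  have g := gX _ FX.
  have [|v' [v'X v'd]] := good_pure g (d := d) (v := v).
    apply: (row_in_submod (f := v \o d) (dom_submod (good_submod g))) => i.
    by exists (w i); apply: Xw.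
  exists v'; split=> // x; have [t Xt] := v'X x; exists t; exact: hatU Xt.
move=> C fC hk hkU; have [n [e esurj]] := fp_generated fC.
have [i|X [FX Xe]] := @hatD F n (fun i => hk (e (delta_mx 0 i))) Ftot; first exact: hkU.
apply: (good_Phi (gX _ FX)) => c; have [x <-] := esurj c.
exact: (row_in_submod (f := hk \o e) (good_submod (gX _ FX))).
Qed.

(** [Phi fC h k] is to be read as: [k] is an admissible lift of the test map [h]. A maximal good
    graph is defined on all of [Y] by [good_extend]. *)
Theorem local_lifting : exists K : {linear Y -> W},
  forall (C : lmodType R) (fC : finitely_presented C) h, Phi fC h (K \o h).
Proof.
have [X [gX maxX]] := Zorn_bigcup good_chain.
pose G := hat X.
have Gtot y : exists w, G (y, w).
  apply: contrapT => ny.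
  have [|G' [gG' GG' nG'G]] := @good_extend G y gX; first by move=> w Gw; apply: ny; exists w.
  apply: (maxX G').
    split=> [z Xz|G'X]; first by apply: GG'; right.
    by apply: nG'G => z /G'X; right.
  rewrite /= (_ : hat G' = G') //; apply/funext => z; apply/propext.
  by split=> [[->|]|] //; [apply: submod0 (good_submod gG') | right].
have [|w Gw|K [KG _]] := @linear_of_graph R Y W (fun y w => G (y, w)) _ Gtot.
- move=> c x y u v Gxu Gyv; exact: (submodP (good_submod gX) c Gxu Gyv).
- exact: good_fun gX _ Gw.
exists K => C fC h.
have := good_Phi gX fC (hk := pair_lin h (K \o h)) (fun c => KG (h c)).
rewrite (_ : (fst_lin Y W \o _ : {linear C -> Y}) = h); last exact: linear_ext.
by rewrite (_ : (snd_lin Y W \o _ : {linear C -> W}) = K \o h) //; apply: linear_ext.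
Qed.

End LocalLifting.

(** * Products and direct sums of arbitrary families *)

Section DirectSums.
Variables (R : pzRingType) (T : choiceType) (C : T -> lmodType R).

Definition dprod : Type := forall t, C t.
HB.instance Definition _ := gen_eqMixin dprod.
HB.instance Definition _ := gen_choiceMixin dprod.

Let padd (x y : dprod) : dprod := fun t => x t + y t.
Let popp (x : dprod) : dprod := fun t => - x t.
Let pzero : dprod := fun t => 0.
Let pscale (c : R) (x : dprod) : dprod := fun t => c *: x t.
Let dext (x y : dprod) : (forall t, x t = y t) -> x = y.
Proof. exact: functional_extensionality_dep. Qed.

Fact dprod_addA : associative padd. Proof. by move=> x y z; apply: dext => t; apply: addrA. Qed.
Fact dprod_addC : commutative padd. Proof. by move=> x y; apply: dext => t; apply: addrC. Qed.
Fact dprod_add0 : left_id pzero padd. Proof. by move=> x; apply: dext => t; apply: add0r. Qed.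
Fact dprod_addN : left_inverse pzero popp padd.
Proof. by move=> x; apply: dext => t; apply: addNr. Qed.
HB.instance Definition _ :=
  GRing.isZmodule.Build dprod dprod_addA dprod_addC dprod_add0 dprod_addN.

Fact dprod_scaleA a b x : pscale a (pscale b x) = pscale (a * b) x.
Proof. by apply: dext => t; apply: scalerA. Qed.
Fact dprod_scale1 : left_id 1 pscale.
Proof. by move=> x; apply: dext => t; apply: scale1r. Qed.
Fact dprod_scaleDr : right_distributive pscale +%R.
Proof. by move=> c x y; apply: dext => t; apply: scalerDr. Qed.
Fact dprod_scaleDl x : {morph pscale^~ x : a b / a + b}.
Proof. by move=> a b; apply: dext => t; apply: scalerDl. Qed.
HB.instance Definition _ := GRing.Zmodule_isLmodule.Build R dprod
  dprod_scaleA dprod_scale1 dprod_scaleDr dprod_scaleDl.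

Definition dprod_module : lmodType R := dprod.

Lemma dprod_ext (x y : dprod_module) : (forall t, x t = y t) -> x = y.
Proof. exact: dext. Qed.

Fact dproj_linear t : linear (fun x : dprod_module => x t : C t). Proof. by []. Qed.
Definition dproj t : {linear dprod_module -> C t} := mklin (dproj_linear t).

Section Tuple.
Variables (A : lmodType R) (h : forall t, {linear A -> C t}).
Fact dtuple_linear : linear (fun a => (fun t => h t a) : dprod_module).
Proof. by move=> c x y; apply: dprod_ext => t; rewrite linearP. Qed.
Definition dtuple : {linear A -> dprod_module} := mklin dtuple_linear.
End Tuple.

Lemma dprod_injective : (forall t, injective_module (C t)) -> injective_module dprod_module.
Proof.
move=> injC A B f g finj.
have hP t : exists h : {linear B -> C t}, forall x, h (f x) = dproj t (g x).
  exact: (injC t _ _ f (dproj t \o g) finj).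
exists (dtuple (fun t => sval (cid (hP t)))) => x; apply: dprod_ext => t.
exact: (svalP (cid (hP t)) x).
Qed.

Definition finsupp (x : dprod_module) : Prop := exists s : seq T, forall t, t \notin s -> x t = 0.

Fact finsupp_submod : submod finsupp.
Proof.
split=> [|c x y [s sx] [s' sy]]; first by exists [::].
exists (s ++ s') => t; rewrite mem_cat negb_or => /andP[/sx xt /sy yt].
have -> : (c *: x + y) t = c *: x t + y t by [].
by rewrite xt yt scaler0 addr0.
Qed.

Definition dsum : lmodType R := sub_module finsupp_submod.

Fact dcoord_linear t : linear (fun x : dsum => sub_incl finsupp_submod x t : C t).
Proof. by move=> c x y; rewrite linearP. Qed.
Definition dcoord t : {linear dsum -> C t} := mklin (@dcoord_linear t).

Lemma dsum_ext x y : (forall t, dcoord t x = dcoord t y) -> x = y.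
Proof. by move=> exy; apply: (@sub_incl_inj _ _ _ finsupp_submod); apply: dprod_ext. Qed.

Lemma dsum_supp x : exists2 s : seq T, uniq s & forall t, t \notin s -> dcoord t x = 0.
Proof.
have [s sx] := sub_inclP x; exists (undup s); first exact: undup_uniq.
by move=> t; rewrite mem_undup => /sx.
Qed.

Lemma dsum_intro (A : lmodType R) (h : forall t, {linear A -> C t}) :
  (forall a, exists s : seq T, forall t, t \notin s -> h t a = 0) ->
  exists f : {linear A -> dsum}, forall a t, dcoord t (f a) = h t a.
Proof.
move=> hs; have [f fE] := sub_corestrict finsupp_submod (f := dtuple h) hs.
by exists f => a t; rewrite mklinE fE.
Qed.

Let basis_vec t t' (c : C t) : C t' := dfwith (fun t => 0 : C t) c t'.

Let basis_vec_linear t t' : linear (basis_vec (t := t) t').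
Proof.
move=> c x y; rewrite /basis_vec /dfwith; case: eqP => [e|_]; last by rewrite scaler0 addr0.
by case: _ / e.
Qed.

Let dinj_ex t : exists f : {linear C t -> dsum},
  forall c t', dcoord t' (f c) = basis_vec t' c.
Proof.
have [|f fE] := @dsum_intro (C t) (fun t' => mklin (basis_vec_linear (t := t) t')); last by exists f.
move=> c; exists [:: t] => t'; rewrite inE => nt.
by rewrite mklinE /basis_vec dfwith_out // eq_sym.
Qed.

Definition dinj t : {linear C t -> dsum} := sval (cid (dinj_ex t)).

Lemma dcoord_inj t c : dcoord t (dinj t c) = c.
Proof. by rewrite /dinj (svalP (cid (dinj_ex t))) /basis_vec dfwith_in. Qed.

Lemma dcoord_inj_out t t' c : t != t' -> dcoord t' (dinj t c) = 0.
Proof. by move=> nt; rewrite /dinj (svalP (cid (dinj_ex t))) /basis_vec dfwith_out. Qed.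

Lemma dsum_decomp x (s : seq T) : uniq s -> (forall t, t \notin s -> dcoord t x = 0) ->
  x = \sum_(t <- s) dinj t (dcoord t x).
Proof.
move=> us sx; apply: dsum_ext => t; rewrite linear_sum.
have [ts|/[dup]ts /sx->] := boolP (t \in s).
  rewrite (bigD1_seq t) //= dcoord_inj big1 ?addr0 // => t' nt.
  by rewrite dcoord_inj_out.
rewrite big1_seq // => t' /andP[_ t's]; apply: dcoord_inj_out.
by apply: contraNneq ts => <-.
Qed.

Section Copairing.
Variables (V : zmodType) (a : T -> V).

(** Families of infinite support get the default 0; by [fsumE] the value does not depend on the
    chosen list. *)
Definition fsum : V :=
  if pselect (exists2 s : seq T, uniq s & forall t, t \notin s -> a t = 0) is left H
  then \sum_(t <- s2val (cid2 H)) a t else 0.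

Lemma fsumE (s : seq T) : uniq s -> (forall t, t \notin s -> a t = 0) ->
  fsum = \sum_(t <- s) a t.
Proof.
move=> us sa; rewrite /fsum; case: pselect => [H|[]]; last by exists s.
have [us' sa'] := (s2valP (cid2 H), s2valP' (cid2 H)).
move: (s2val _) us' sa' => s' us' sa'.
rewrite (bigID (mem s)) /= [X in _ + X]big1 ?addr0 => [|t]; last exact: sa.
rewrite [RHS](bigID (mem s')) /= [X in _ = _ + X]big1 ?addr0 => [|t]; last exact: sa'.
rewrite -big_filter -[RHS]big_filter; apply: perm_big; apply: uniq_perm.
- exact: filter_uniq.
- exact: filter_uniq.
by move=> t; rewrite !mem_filter /= andbC.
Qed.
End Copairing.

Lemma dsum_elim (Z : lmodType R) (h : forall t, {linear C t -> Z}) :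
  exists f : {linear dsum -> Z}, forall t c, f (dinj t c) = h t c.
Proof.
have f_lin : linear (fun x => fsum (fun t => h t (dcoord t x))).
  move=> c x y; have [s us sx] := dsum_supp x; have [s' us' sy] := dsum_supp y.
  pose s'' := undup (s ++ s').
  have us'' : uniq s'' := undup_uniq _.
  have s''E t : t \notin s'' -> dcoord t x = 0 /\ dcoord t y = 0.
    by rewrite mem_undup mem_cat negb_or => /andP[/sx ? /sy].
  have out z t : dcoord t z = 0 -> h t (dcoord t z) = 0 by move=> ->; rewrite linear0.
  have sum z : (forall t, t \notin s'' -> dcoord t z = 0) ->
      fsum (fun t => h t (dcoord t z)) = \sum_(t <- s'') h t (dcoord t z).
    by move=> z0; apply: fsumE => // t /z0/out.
  rewrite !sum; [|by move=> t /s''E[]|by move=> t /s''E[]|]; last first.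
    by move=> t /s''E[xt yt]; rewrite linearP xt yt scaler0 addr0.
  by rewrite scaler_sumr -big_split /=; apply: eq_bigr => t _; rewrite !linearP.
exists (mklin f_lin) => t c; rewrite mklinE (fsumE (s := [:: t])) //.
  by rewrite big_seq1 dcoord_inj.
by move=> t'; rewrite inE eq_sym => nt; rewrite dcoord_inj_out ?linear0.
Qed.

(** The supports of the images of the finitely many generators together suffice. *)
Lemma dsum_fg_supp (A : lmodType R) n (e : {linear 'rV[R]_n -> A}) (k : {linear A -> dsum}) :
  (forall a, exists v, e v = a) ->
  exists2 s : seq T, uniq s & forall a t, t \notin s -> dcoord t (k a) = 0.
Proof.
move=> esurj; pose s i := s2val (cid2 (dsum_supp (k (e (delta_mx 0 i))))).
exists (undup (flatten [seq s i | i <- enum 'I_n])); first exact: undup_uniq.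
move=> a t; rewrite mem_undup => nt; have [v <-] := esurj a.
apply: (row_in_submod (f := k \o e) (submod_ker (dcoord t))) => i.
apply: (s2valP' (cid2 (dsum_supp (k (e (delta_mx 0 i)))))).
by apply: contra nt => ts; apply/flatten_mapP; exists i; rewrite ?mem_enum.
Qed.

Lemma dsum_fg_decomp (A : lmodType R) (k : {linear A -> dsum}) (s : seq T) : uniq s ->
  (forall a t, t \notin s -> dcoord t (k a) = 0) ->
  k = \sum_(t <- s) (dinj t \o (dcoord t \o k) : {linear A -> dsum}).
Proof.
move=> us sk; apply: linear_ext => a; rewrite lin_sumE.
by apply: dsum_decomp => // t; apply: sk.
Qed.

End DirectSums.

Arguments dinj {R T C} t.
Arguments dcoord {R T C} t.

(** * A uniform length bound and injectivity of direct sums *)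

Section UniformLength.
Variable R : pzRingType.

Lemma uniform_length : finite_length (R^o : lmodType R) -> finite_representation_type R ->
  exists L, forall A : lmodType R, finitely_presented A -> indecomposable A -> length_le A L.
Proof.
move=> flR [n [M_ MP]].
have bound i : exists L, forall A : lmodType R,
    finitely_presented A -> module_iso A (M_ i) -> length_le A L.
  (* The bound is transported from some finitely presented module isomorphic to [M_ i]; if there is
     none, 0 serves. *)
  have [[A0 [fpA0 [f0 [g0 f0K g0K]]]]|no] :=
    pselect (exists A0 : lmodType R, finitely_presented A0 /\ module_iso A0 (M_ i)); last first.
    by exists 0%N => A fpA iA; case: no; exists A.
  have [L lenL] := finite_length_bound (finite_length_fp flR fpA0).
  have [|b|k [_ kK]] := @linear_bij_inv R _ _ f0; [exact: can_inj f0K | by exists (g0 b) |].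
  exists L => A fpA [f [g fK _]]; apply: (length_le_inj (f := k \o f)) lenL.
  exact: inj_comp (can_inj kK) (can_inj fK).
exists (\max_i sval (cid (bound i)))%N => A fpA indA.
have [i iA] := MP A fpA indA => d K sK ch.
apply: leq_trans (leq_bigmax i); exact: (svalP (cid (bound i)) A fpA iA d K sK ch).
Qed.

End UniformLength.

(* The direct sum is pure in the product, and every module is pure-projective, so
   the direct sum is a direct summand of the product. *)
Lemma dsum_injective (R : pzRingType) L (T : choiceType) (C : T -> lmodType R) :
  finite_length (R^o : lmodType R) ->
  (forall A : lmodType R, finitely_presented A -> indecomposable A -> length_le A L) ->
  (forall t, injective_module (C t)) -> injective_module (dsum C).
Proof.
move=> flR lenL injC.
pose sF := finsupp_submod C; pose q := qproj sF.
pose Phi (A : lmodType R) (fA : finitely_presented A) (h : {linear A -> quot_module sF})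
  (k : {linear A -> dprod_module C}) := forall a, q (k a) = h a.
have [|||K KP] := local_lifting flR lenL (Phi := Phi).
- move=> A [m [n [d [e [esurj ekerP]]]]] h.
  have [v vE] := row_lift (h \o e) (@qproj_surj _ _ _ sF).
  have vdF i : finsupp (v (d (delta_mx 0 i))).
    apply/(qproj_eq0 sF); rewrite vE /=; suff -> : e (d (delta_mx 0 i)) = 0 by rewrite linear0.
    by apply/ekerP; exists (delta_mx 0 i).
  (* [s] collects the supports of the images of the relations. Erasing these coordinates of [v]
     kills the relations and changes [v] only by elements of finite support. *)
  pose s := flatten [seq sval (cid (vdF i)) | i <- enum 'I_m].
  pose vt t : {linear 'rV[R]_n -> C t} := if t \in s then \0 : {linear _ -> _} else (dproj C t \o v : {linear _ -> _}).
  pose v' := dtuple vt.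
  have v'E x t : v' x t = if t \in s then 0 else v x t.
    by rewrite /v' mklinE /vt; case: ifP.
  have v'd x : v' (d x) = 0.
    apply: (row_in_submod (f := v' \o d) (submod_zero _)) => i; apply: dprod_ext => t.
    rewrite /= v'E; case: ifPn => // ts; apply: (svalP (cid (vdF i))).
    by apply: contra ts => ti; apply/flatten_mapP; exists i; rewrite ?mem_enum.
  have [_ /ekerP[w <-]|k kE] := linear_factor_surj (p := e) (f := v') esurj; first exact: v'd.
  exists k => a; have [x <-] := esurj a; rewrite kE -[RHS]vE.
  apply/eqP; rewrite -subr_eq0 -linearB; apply/eqP/(qproj_eq0 sF); exists s => t ts.
  have -> : (v' x - v x) t = v' x t - v x t by [].
  by rewrite v'E (negPf ts) subrr.
- by move=> A B fA fB u h k kP a; apply: kP.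
- by move=> A fA h h' k k' kP k'P a; rewrite lin_subE linearB kP k'P.
(* Testing on the map from the free module of rank one that hits [y] shows that [K] splits [q]; then
   [1 - K q] retracts the product onto the direct sum. *)
have qK y : q (K y) = y.
  have := KP _ (fp_row R 1) (row_lin (fun=> y)) (delta_mx 0 0).
  by rewrite /= row_lin_delta.
pose r : {linear dprod_module C -> dprod_module C} :=
  (idfun : {linear dprod_module C -> dprod_module C}) - (K \o q : {linear _ -> _}).
have rE x : r x = x - K (q x) by [].
have [|r' r'E] := sub_corestrict sF (f := r).
  by move=> x; apply/(qproj_eq0 sF); rewrite rE linearB qK subrr.
have r'K x : r' (sub_incl sF x) = x.
  apply: (@sub_incl_inj _ _ _ sF); rewrite r'E rE.
  have -> : q (sub_incl sF x) = 0 by apply/(qproj_eq0 sF); exact: sub_inclP.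
  by rewrite linear0 subr0.
move=> A B f g finj.
have [h hE] := dprod_injective injC (sub_incl sF \o g) finj.
by exists (r' \o h) => x /=; rewrite hE /= r'K.
Qed.

(** * Maps that factor through projective modules *)

Section ProjectivesInTrace.
Variable R : pzRingType.

Lemma projective_row n : projective_module ('rV[R]_n : lmodType R).
Proof. by move=> A B f g fsurj; apply: row_lift. Qed.

Lemma projective_regular : projective_module (R^o : lmodType R).
Proof.
move=> A B f g fsurj; have [a fa] := fsurj (g 1).
have h_lin : linear (fun r : R^o => (r : R) *: a).
  by move=> c r s; rewrite scalerDl scalerA.
exists (mklin h_lin) => r; rewrite mklinE linearZ_LR /= fa -linearZ_LR /=.
by congr (g _); apply: mulr1.
Qed.

Definition free_cover (Y : lmodType R) : lmodType R := dsum (fun _ : Y => (R^o : lmodType R)).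

Lemma free_cover_map (Y : lmodType R) : exists d : {linear free_cover Y -> Y},
  forall y, exists x, d x = y.
Proof.
have h_lin (y : Y) : linear (fun r : R^o => (r : R) *: y).
  by move=> c r s; rewrite scalerDl scalerA.
have [d dE] := dsum_elim (fun y => mklin (h_lin y)).
by exists d => y; exists (dinj (C := fun _ : Y => (R^o : lmodType R)) y (1 : R)); rewrite dE mklinE scale1r.
Qed.

Lemma trace_sum (Y : lmodType R) (C : fp_cat R) I (s : seq I)
    (F : I -> {linear (sval C : lmodType R) -> Y}) :
  (forall i, @trace _ (@fp_projective R) (hom_presheaf Y) C (F i)) ->
  @trace _ (@fp_projective R) (hom_presheaf Y) C (\sum_(i <- s) F i).
Proof.
move=> trF; elim/big_rec: _ => [|i x _]; first exact: trace0.
exact: trace_add.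
Qed.

(** A map from a finitely generated module meets only finitely many summands, so the composite is a
    finite sum of maps through the single [P t]. *)
Lemma trace_dsum (T : choiceType) (P : T -> lmodType R) (Y : lmodType R) (C : fp_cat R)
    (g : {linear dsum P -> Y}) (k : {linear (sval C : lmodType R) -> dsum P}) :
  (forall t, projective_module (P t)) -> (forall t, finitely_presented (P t)) ->
  @trace _ (@fp_projective R) (hom_presheaf Y) C (g \o k : {linear _ -> _}).
Proof.
move=> projP fpP; case: C k => C fC /= k.
have [n [e esurj]] := fp_generated fC.
have [s us sk] := dsum_fg_supp k esurj.
have -> : g \o k = \sum_(t <- s) (g \o dinj (C := P) t \o (dcoord t \o k) : {linear C -> Y})
    :> {linear C -> Y}.
  rewrite {1}(dsum_fg_decomp us sk); apply: linear_ext => x.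
  by rewrite /= !lin_sumE linear_sum.
apply: (@trace_sum Y (exist _ C fC)) => t.
rewrite -[X in trace _ X]addr0.
apply: (@traceD _ (@fp_projective R) (hom_presheaf Y) (exist _ C fC)
  (exist _ (P t) (fpP t)) (dcoord t \o k : {linear _ -> _}) (g \o dinj t : {linear _ -> _}));
  [exact: projP | exact: trace0].
Qed.

(** Maps from finitely presented projectives lift along the cover; the converse is [trace_dsum] for
    copies of [R]. *)
Lemma trace_free_cover (Y : lmodType R) (d : {linear free_cover Y -> Y}) (C : fp_cat R)
    (t : {linear (sval C : lmodType R) -> Y}) : (forall y, exists x, d x = y) ->
  @trace _ (@fp_projective R) (hom_presheaf Y) C t <->
  exists k : {linear (sval C : lmodType R) -> free_cover Y}, forall x, d (k x) = t x.
Proof.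
move=> dsurj; split=> [|[k kE]].
  elim=> [|[q fq] h v u projq _ [k kE]]; first by exists \0 => x; rewrite linear0.
  have [v' v'E] := projq _ _ d v dsurj.
  exists ((v' \o h : {linear (sval C : lmodType R) -> free_cover Y}) + k) => x.
  by rewrite lin_addE linearD kE /= v'E.
rewrite (_ : t = d \o k); last by apply: linear_ext => x; rewrite /= kE.
apply: trace_dsum => _; [exact: projective_regular | exact: fp_regular].
Qed.

End ProjectivesInTrace.

(** * Elements of the functors in the image of [Theta] *)

Section StableQuotient.
Variables (A : precat) (Q : A -> Prop) (F : ab_presheaf A) (S : subfunctor F).

(** This is the iterated quotient to which the composite of cokernel and [i_lambda] unfolds. *)
Definition stable_quot : ab_presheaf A := quot_functor (trace_sub Q (quot_functor S)).

Definition stable_pi (x : A) (u : psh_val F x) : psh_val stable_quot x :=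
  quot_pi (trace_sub Q (quot_functor S)) x (quot_pi S x u : psh_val (quot_functor S) x).

Lemma stable_pi_surj x q : exists u, @stable_pi x u = q.
Proof.
exists (repr (repr (q : quot_ob (trace_sub Q (quot_functor S)) x) : quot_ob S x)).
by rewrite /stable_pi (quot_reprK (S := S)) quot_reprK.
Qed.

Lemma stable_piB x u v : @stable_pi x (u - v) = stable_pi u - stable_pi v.
Proof.
by rewrite /stable_pi (raddfB (quot_pi S x)) (raddfB (quot_pi (trace_sub Q (quot_functor S)) x)).
Qed.

Lemma stable_pi_res (x y : A) (h : Defs.hom x y) u :
  psh_res stable_quot h (stable_pi u) = stable_pi (psh_res F h u).
Proof.
by rewrite /stable_pi [LHS]quot_res_pi; congr (quot_pi _ _ _); apply: (@quot_res_pi _ _ S).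
Qed.

(** The projection is surjective at every object, so the trace of the quotient by [S] is the image
    of the trace of [F]. *)
Lemma stable_pi_eq0 x u : @stable_pi x u = 0 <->
  exists2 t, trace Q t & S x (u - t).
Proof.
apply: iff_trans (quot_pi_eq0 (trace_sub Q (quot_functor S)) _) _; split=> /= [|[t trt]].
  suff H (w : psh_val (quot_functor S) x) : trace Q w ->
      exists2 t, trace Q t & w = quot_pi S x t.
    by case/H => t trt /(quot_piP S)Sut; exists t.
  elim=> [|q l v {}w Qq _ [t trt ->]].
    by exists 0; [exact: trace0 | rewrite raddf0].
  exists (psh_res F l (repr (v : quot_ob S q)) + t); first exact: traceD.
  by rewrite raddfD; congr (_ + _); rewrite -(@quot_res_pi _ _ S) quot_reprK.
by move=> /(quot_piP S)->; exact: (trace_nat (quot_proj S) trt).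
Qed.

End StableQuotient.

Section StableQuotientMap.
Variables (A : precat) (Q : A -> Prop) (F G : ab_presheaf A).
Variables (S : subfunctor F) (S' : subfunctor G) (a : Defs.hom F G).
Hypothesis aS : forall x u, S x u -> psh_app (quot_proj S' \co a)%cat x u = 0.
Hypothesis trS : forall x u, trace_sub Q (quot_functor S) x u ->
  psh_app (quot_proj (trace_sub Q (quot_functor S')) \co quot_lift aS)%cat x u = 0.

Lemma stable_pi_lift x u : psh_app (quot_lift trS) x (stable_pi Q S u) =
  stable_pi Q S' (psh_app a x u).
Proof.
apply: etrans (quot_lift_pi trS _) _.
by congr (quot_pi _ _ _); apply: (quot_lift_pi aS u).
Qed.

End StableQuotientMap.

Section ThetaElements.
(* Otherwise the conversion test descends into the proof fields of these functors. *)
#[local] Strategy opaque [quot_functor quot_lift Defs.image_sub trace_sub].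
Variable R : pzRingType.
Implicit Types (f g : S_cat R) (C : fp_cat R).

Definition ssrc f : lmodType R := asrc (sval f).
Definition stgt f : lmodType R := atgt (sval f).
Definition smap f : {linear ssrc f -> stgt f} := amor (sval f).

Lemma smap_inj f : injective (smap f).
Proof. by apply/monomorphismP; exact: (svalP f). Qed.

Definition hom_cok f : subfunctor (hom_presheaf (stgt f)) :=
  Defs.image_sub (arrow_functor (hom_functor R) (sval f)).

Definition theta f : ab_presheaf (fp_cat R) := stable_quot (@fp_projective R) (hom_cok f).

Definition theta_map f g (s : Defs.hom f g) : nattrans (theta f) (theta g) :=
  fmor (Theta R) s.

Definition theta_pi f C (h : {linear (sval C : lmodType R) -> stgt f}) :
  psh_val (theta f) C := @stable_pi _ (@fp_projective R) _ (hom_cok f) C h.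

Lemma theta_pi_surj f C q : exists h, @theta_pi f C h = q.
Proof. exact (@stable_pi_surj _ (@fp_projective R) _ (hom_cok f) C q). Qed.

Lemma theta_piB f C h k : @theta_pi f C (h - k) = theta_pi h - theta_pi k.
Proof. exact (@stable_piB _ (@fp_projective R) _ (hom_cok f) C h k). Qed.

Lemma theta_pi_res f (C D : fp_cat R) (u : {linear (sval D : lmodType R) -> (sval C : lmodType R)})
    (h : {linear (sval C : lmodType R) -> stgt f}) :
  psh_res (theta f) (u : @Defs.hom (fp_cat R) D C) (theta_pi h) =
  theta_pi (f := f) (h \o u : {linear _ -> _}).
Proof. exact: (@stable_pi_res _ _ _ (hom_cok f) D C u h). Qed.

Lemma theta_map_pi f g (s : Defs.hom f g) C (h : {linear (sval C : lmodType R) -> stgt f}) :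
  psh_app (theta_map s) C (theta_pi h) =
  theta_pi (f := g) ((sq_tgt s : {linear stgt f -> stgt g}) \o h : {linear _ -> _}).
Proof.
exact (@stable_pi_lift (fp_cat R) (@fp_projective R) (hom_presheaf (stgt f))
  (hom_presheaf (stgt g)) (hom_cok f) (hom_cok g) _ _ _ C h).
Qed.

Lemma theta_pi_eq0_trace f C h : @theta_pi f C h = 0 <->
  exists t (u : {linear (sval C : lmodType R) -> ssrc f}),
    @trace _ (@fp_projective R) (hom_presheaf (stgt f)) C t /\
    forall x, h x = smap f (u x) + (t : {linear (sval C : lmodType R) -> stgt f}) x.
Proof.
apply: iff_trans (@stable_pi_eq0 _ _ _ (hom_cok f) C h) _; split.
  case=> t trt [u uE]; exists t, u; split=> // x.
  have /(congr1 (fun l : {linear (sval C : lmodType R) -> stgt f} => l x)) := uE.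
  by rewrite lin_subE => /= ->; rewrite subrK.
case=> t [u [trt hE]]; exists t => //.
by exists u; apply: linear_ext => x; rewrite lin_subE hE addrK.
Qed.

(** The explicit description of [Theta] as the cokernel induced by [[d f]], with a free cover of the
    whole target as the projective part. *)
Lemma theta_pi_eq0 f C (d : {linear free_cover (stgt f) -> stgt f}) h :
  (forall y, exists x, d x = y) ->
  @theta_pi f C h = 0 <->
  exists (u : {linear (sval C : lmodType R) -> ssrc f})
         (k : {linear (sval C : lmodType R) -> free_cover (stgt f)}),
    forall x, h x = smap f (u x) + d (k x).
Proof.
move=> dsurj; apply: iff_trans (@theta_pi_eq0_trace f C h) _; split.
  case=> t [u [/(trace_free_cover _ dsurj)[k kE] hE]]; exists u, k => x.
  by rewrite kE hE.
case=> u [k hE]; exists (d \o k : {linear (sval C : lmodType R) -> stgt f}), u.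
by split=> //; apply/(trace_free_cover _ dsurj); exists k.
Qed.

End ThetaElements.

(** * Fullness and objectivity *)

Section ThetaFunctor.
Variables (R : pzRingType) (L : nat).
Hypothesis flR : finite_length (R^o : lmodType R).
Hypothesis lenL : forall A : lmodType R,
  finitely_presented A -> indecomposable A -> length_le A L.
Hypothesis injR : injective_module (R^o : lmodType R).
Implicit Types (f g : S_cat R).

Let fp_ob (C : lmodType R) (fC : finitely_presented C) : fp_cat R := exist _ C fC.

(** Vanishing on every test map means that [k h] always lifts along [[f d]]; these lifts are the
    admissible ones for [local_lifting]. *)
Lemma lift_modulo_cover f (Y : lmodType R) (d : {linear free_cover (stgt f) -> stgt f})
    (k : {linear Y -> stgt f}) : (forall y, exists x, d x = y) ->
  (forall C (h : {linear (sval C : lmodType R) -> Y}),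
     @theta_pi R f C (k \o h : {linear _ -> _}) = 0) ->
  exists (u : {linear Y -> ssrc f}) (p : {linear Y -> free_cover (stgt f)}),
    forall y, k y = smap f (u y) + d (p y).
Proof.
move=> dsurj k0.
pose t := copair_lin (smap f) d.
pose Phi (C : lmodType R) (fC : finitely_presented C) (h : {linear C -> Y})
  (l : {linear C -> (ssrc f * free_cover (stgt f))%type}) := forall c, t (l c) = k (h c).
have [|||K KP] := local_lifting flR lenL (Phi := Phi).
- move=> C fC h; have /(theta_pi_eq0 _ dsurj)[u [p e]] := k0 (fp_ob fC) h.
  by exists (pair_lin u p) => c; exact/esym/e.
- by move=> C D fC fD u h l hl c; apply: hl.
- by move=> C fC h h' l l' hl hl' c; rewrite !lin_subE !linearB hl hl'.
exists (fst_lin _ _ \o K), (snd_lin _ _ \o K) => y.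
have := KP _ (fp_row R 1) (row_lin (fun=> y)) (delta_mx 0 0).
by rewrite /= row_lin_delta => <-.
Qed.

Lemma theta_full f g (a : Defs.hom (theta f) (theta g)) :
  exists s : Defs.hom f g, theta_map s = a.
Proof.
pose Phi (C : lmodType R) (fC : finitely_presented C)
  (h : {linear C -> stgt f}) (k : {linear C -> stgt g}) :=
  psh_app a (fp_ob fC) (theta_pi (C := fp_ob fC) h) = theta_pi (C := fp_ob fC) k.
have [|||k kP] := local_lifting flR lenL (Phi := Phi).
- move=> C fC h; have [k kE] := theta_pi_surj (psh_app a (fp_ob fC) (theta_pi (C := fp_ob fC) h)).
  by exists k.
- move=> C D fC fD u h k; rewrite /Phi => e.
  rewrite -(theta_pi_res (D := fp_ob fD) (C := fp_ob fC) u h) psh_appP e.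
  exact: theta_pi_res.
- move=> C fC h h' k k'; rewrite /Phi => e e'.
  by rewrite !theta_piB raddfB e e'.
have [d dsurj] := free_cover_map (stgt g).
have [df dfsurj] := free_cover_map (stgt f).
(* The class of [f h] is zero, so [a] sends it to zero and the class of [k f h] vanishes for every
   test map [h]. *)
have [C h|u [p kE]] := lift_modulo_cover (f := g) (k := k \o smap f) dsurj.
  have e : theta_pi (f := f) (C := C) (smap f \o h : {linear _ -> _}) = 0.
    by apply/(theta_pi_eq0 _ dfsurj); exists h, \0 => x; rewrite linear0 addr0.
  case: C h e => C fC h e; have := kP C fC (smap f \o h).
  rewrite /Phi e raddf0 => /esym e'; rewrite -[RHS]e'.
  by congr theta_pi; apply: linear_ext.
(* The free cover is injective as a direct sum of copies of [R], so [p] extends along the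
   monomorphism [f]. Subtracting [d p'] from [k] makes the square commute and changes classes only
   by the trace. *)
have [p' p'E] := dsum_injective flR lenL (fun=> injR) p (smap_inj (f := f)).
have [k' k'V] : exists k' : {linear stgt f -> stgt g}, forall x, k' x = k x - d (p' x).
  by exists (k - (d \o p' : {linear _ -> _})).
have k'E : k' \o smap f = smap g \o u :> {linear ssrc f -> stgt g}.
  apply: linear_ext => x; rewrite /= k'V p'E.
  by rewrite -[k _]/((k \o smap f) x) kE addrK.
pose s : Defs.hom f g := @Square _ (sval f) (sval g) u k' k'E.
exists s; apply: (psh_app_ext (G := theta g)) => C q.
have [h <-] := theta_pi_surj q; rewrite theta_map_pi.
case: C h {q} => C fC h; have := kP C fC h; rewrite /Phi => ->.
apply/eqP; rewrite -subr_eq0 -theta_piB; apply/eqP/(theta_pi_eq0 _ dsurj).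
have [p'' p''E] : exists p'' : {linear C -> free_cover (stgt g)}, forall x, p'' x = - p' (h x).
  by exists (\- (p' \o h)).
exists \0, p'' => x; apply: etrans (lin_subE _ _ _) _.
by rewrite linear0 add0r p''E linearN /= k'V addrAC subrr add0r.
Qed.

Lemma theta_objective f g (s : Defs.hom f g) : (forall C q, psh_app (theta_map s) C q = 0) ->
  exists (k : S_cat R) (a : Defs.hom f k) (b : Defs.hom k g),
    (forall C (q : psh_val (theta k) C), q = 0) /\ s = (b \co a)%cat.
Proof.
move=> s0; have [d dsurj] := free_cover_map (stgt g).
pose k1 : {linear ssrc f -> ssrc g} := sq_src s.
pose k2 : {linear stgt f -> stgt g} := sq_tgt s.
have k12 x : k2 (smap f x) = smap g (k1 x).
  by have /(congr1 (fun l : {linear ssrc f -> stgt g} => l x)) := squareP s.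
have [C h|u [p kE]] := lift_modulo_cover (f := g) (k := k2) dsurj.
  by rewrite -theta_map_pi s0.
pose W : lmodType R := (ssrc g * free_cover (stgt g))%type.
pose t : {linear W -> stgt g} := copair_lin (smap g) d.
(* [N] is the pullback of [g] along [t = [g d]]; its projection to [W] is injective because [g]
   is. *)
have sN : submod (fun z : (W * ssrc g)%type => t z.1 = smap g z.2).
  split=> [|c x y ex ey]; first by rewrite !linear0.
  by rewrite !linearP ex ey.
pose N := sub_module sN.
pose i : {linear N -> W} := fst_lin W (ssrc g) \o sub_incl sN.
have i_inj : injective i.
  apply: linear_inj0 => z z0; apply: (@sub_incl_inj _ _ _ sN); rewrite linear0.
  have e := sub_inclP z; have z1 : (sub_incl sN z).1 = 0 := z0.
  move: e; rewrite z1 linear0 => /esym z2.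
  rewrite [LHS]surjective_pairing z1; congr pair.
  by apply: (smap_inj (f := g)); rewrite z2 linear0.
pose k : S_cat R := exist _ (@Arrow (module_cat R) N W i) ((monomorphismP i).2 i_inj).
have [a1 a1E] : exists a1 : {linear ssrc f -> N},
    forall x, sub_incl sN (a1 x) = ((u (smap f x), p (smap f x)), k1 x).
  apply: (sub_corestrict sN (f := pair_lin (pair_lin (u \o smap f) (p \o smap f)) k1)) => x.
  by rewrite /= -k12 kE.
pose a2 : {linear stgt f -> W} := pair_lin u p.
have aP : a2 \o smap f = i \o a1 :> {linear ssrc f -> W}.
  by apply: linear_ext => x; rewrite /i /= a1E.
have bP : t \o i = smap g \o (snd_lin W (ssrc g) \o sub_incl sN) :> {linear N -> stgt g}.
  by apply: linear_ext => x; exact: (sub_inclP x).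
pose a : Defs.hom f k := @Square _ (sval f) (sval k) a1 a2 aP.
pose b : Defs.hom k g := @Square _ (sval k) (sval g) _ _ bP.
exists k, a, b; split; last first.
  apply: square_ext; apply: linear_ext => x /=; first by rewrite a1E.
  exact: kE.
move=> C q; have [h <-] := theta_pi_surj q.
pose h2 : {linear (sval C : lmodType R) -> free_cover (stgt g)} := snd_lin _ _ \o (h : {linear _ -> W}).
pose h1 : {linear (sval C : lmodType R) -> ssrc g} := fst_lin _ _ \o (h : {linear _ -> W}).
pose inr : {linear free_cover (stgt g) -> W} := pair_lin \0 idfun.
(* The component of [h] in the source of [g] lifts to [N], and the component in the free cover lies
   in the trace, so the class of [h] is zero. *)
have [r rE] : exists r : {linear (sval C : lmodType R) -> N},
    forall x, sub_incl sN (r x) = ((h1 x, 0), h1 x).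
  apply: (sub_corestrict sN (f := pair_lin (pair_lin h1 \0) h1)) => x.
  by rewrite /t /= copair_linE /= linear0 addr0.
apply/theta_pi_eq0_trace; exists (inr \o h2 : {linear (sval C : lmodType R) -> W}), r; split.
  by apply: trace_dsum => _; [exact: projective_regular | exact: fp_regular].
move=> x; have -> : smap k (r x) = (h1 x, 0) by rewrite /smap /= /i /= rE.
by rewrite [LHS]surjective_pairing; congr pair; rewrite /= ?addr0 ?add0r.
Qed.

End ThetaFunctor.

(** * Isomorphisms of functors and presentations by direct sums *)

Section AdditiveMaps.
Variables (A B : zmodType) (f : A -> B) (f_add : zmod_morphism f).
Definition mkadd_fun of zmod_morphism f := f.
HB.instance Definition _ := GRing.isZmodMorphism.Build A B (mkadd_fun f_add) f_add.
Definition mkadd : {additive A -> B} := mkadd_fun f_add.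
End AdditiveMaps.

Section PresheafIsomorphism.
Variable A : precat.

(** The analogue of [linear_of_graph]: a map out of a quotient is described on representatives, and
    uniqueness of values gives additivity and naturality. *)
Lemma nattrans_of_relation (F G : ab_presheaf A)
    (P : forall x, psh_val F x -> psh_val G x -> Prop) :
  (forall x u, exists v, P x u v) ->
  (forall x u v u' v', P x u v -> P x u' v' -> P x (u - u') (v - v')) ->
  (forall x v, P x 0 v -> v = 0) ->
  (forall x y (h : Defs.hom x y) u v, P y u v -> P x (psh_res F h u) (psh_res G h v)) ->
  exists a : Defs.hom F G, forall x u v, P x u v -> psh_app a x u = v.
Proof.
move=> Ptot PB P0 Pres.
have Puniq x u v v' : P x u v -> P x u v' -> v = v'.
  move=> Pv Pv'; have := PB _ _ _ _ _ Pv Pv'; rewrite subrr => /P0/eqP.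
  by rewrite subr_eq0 => /eqP.
pose a x u := sval (cid (Ptot x u)); have aP x u : P x u (a x u) by apply: svalP.
have a_add x : zmod_morphism (a x).
  by move=> u v; apply: Puniq (aP _ _) (PB _ _ _ _ _ (aP _ _) (aP _ _)).
have aN x y (h : @Defs.hom (op A) x y) :
    (@mkadd _ _ _ (a_add y) \o psh_res F h : {additive _ -> _}) =
    (psh_res G h \o @mkadd _ _ _ (a_add x) : {additive _ -> _}).
  by apply: additive_ext => u; apply: Puniq (aP _ _) (Pres _ _ _ _ _ (aP _ _)).
exists (@Nattrans (op A) ab_cat F G (fun x => mkadd (a_add x)) aN) => x u v Puv.
exact: Puniq (aP _ _) Puv.
Qed.

Lemma isomorphic_of_relation (F G : ab_presheaf A)
    (P : forall x, psh_val F x -> psh_val G x -> Prop) :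
  (forall x u, exists v, P x u v) -> (forall x v, exists u, P x u v) ->
  (forall x u v u' v', P x u v -> P x u' v' -> P x (u - u') (v - v')) ->
  (forall x v, P x 0 v -> v = 0) -> (forall x u, P x u 0 -> u = 0) ->
  (forall x y (h : Defs.hom x y) u v, P y u v -> P x (psh_res F h u) (psh_res G h v)) ->
  isomorphic F G.
Proof.
move=> PtotF PtotG PB P0F P0G Pres.
have [a aP] := nattrans_of_relation PtotF PB P0F Pres.
have [||b bP] := @nattrans_of_relation G F (fun x v u => P x u v) PtotG _ P0G.
- by move=> x u v u' v'; apply: PB.
- by move=> x y h u v; apply: Pres.
exists a, b; split; apply: psh_app_ext => x u.
- have [v Puv] := PtotF x u; apply: etrans (congr1 (psh_app b x) (aP _ _ _ Puv)) _.
  exact: bP.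
- have [v Puv] := PtotG x u; apply: etrans (congr1 (psh_app a x) (bP _ _ _ Puv)) _.
  exact: aP.
Qed.

End PresheafIsomorphism.

Section Presentation.
Variable R : pzRingType.

(* Finitely presented modules form a proper class, but direct sums need a set. *)
Definition presentation : Type :=
  {m : nat & {n : nat & {linear 'rV[R]_m -> 'rV[R]_n}}}.

Definition presented (d : presentation) : lmodType R :=
  quot_module (submod_range (projT2 (projT2 d))).

Lemma fp_presented d : finitely_presented (presented d).
Proof.
apply: (fp_quotient (j := projT2 (projT2 d)) (fp_row R _) (@qproj_surj _ _ _ _)).
exact: qproj_eq0.
Qed.

Lemma presentedP (C : lmodType R) : finitely_presented C ->
  exists d (j : {linear C -> presented d}) (j' : {linear presented d -> C}), cancel j j'.
Proof.
move=> [m [n [d [e [esurj ekerP]]]]].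
exists (existT _ m (existT _ n d)).
have [|j jE] := linear_factor_surj (p := e) (f := qproj (submod_range d)) esurj.
  by move=> v /ekerP dv; apply/(qproj_eq0 (submod_range d)).
have [|j' j'E] := linear_factor_surj (p := qproj (submod_range d)) (f := e) (@qproj_surj _ _ _ _).
  by move=> v /(qproj_eq0 (submod_range d)) dv; apply/ekerP.
by exists j, j' => x; have [v <-] := esurj x; rewrite jE j'E.
Qed.

Definition fp_presented_ob d : fp_cat R := exist _ (presented d) (fp_presented d).

Variable F : ab_presheaf (fp_cat R).

Lemma psh_res0 (C D : fp_cat R) (u : psh_val F D) :
  psh_res F (hom0 C D : Defs.hom C D) u = 0.
Proof.
apply: (@addrI _ (psh_res F (hom0 C D) u)); rewrite addr0 -psh_resD.
by rewrite hom0D.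
Qed.

Section Evaluation.
Variables (T : choiceType) (C : T -> fp_cat R) (u_ : forall t, psh_val F (C t)).

Definition family_sum : lmodType R := dsum (fun t => sval (C t) : lmodType R).

Definition ev_term (A : fp_cat R) (k : {linear (sval A : lmodType R) -> family_sum}) t :
  psh_val F A :=
  psh_res F ((dcoord t \o k : {linear (sval A : lmodType R) -> (sval (C t) : lmodType R)}) :
    Defs.hom A (C t)) (u_ t).

(* The Yoneda correspondence for a direct sum: ev A k = sum_t F(k_t)(u_t). *)
Definition ev (A : fp_cat R) (k : {linear (sval A : lmodType R) -> family_sum}) :
  psh_val F A := fsum (ev_term k).

Lemma ev_supp (A : fp_cat R) (k : {linear (sval A : lmodType R) -> family_sum}) :
  exists2 s : seq T, uniq s & forall a t, t \notin s -> dcoord t (k a) = 0.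
Proof.
case: A k => A fA /= k; have [n [e esurj]] := fp_generated fA.
exact: dsum_fg_supp esurj.
Qed.

Lemma ev_term0 (A : fp_cat R) (k : {linear (sval A : lmodType R) -> family_sum}) t :
  (forall a, dcoord t (k a) = 0) -> ev_term k t = 0.
Proof.
move=> kt; rewrite /ev_term.
rewrite (_ : (dcoord t \o k : {linear (sval A : lmodType R) -> (sval (C t) : lmodType R)}) = 0).
  exact: psh_res0.
by apply: linear_ext => a; rewrite /= kt.
Qed.

Lemma ev_sum (A : fp_cat R) (k : {linear (sval A : lmodType R) -> family_sum}) s : uniq s ->
  (forall a t, t \notin s -> dcoord t (k a) = 0) -> ev k = \sum_(t <- s) ev_term k t.
Proof.
by move=> us sk; apply: fsumE => // t ts; apply: ev_term0 => a; apply: sk.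
Qed.

Lemma ev_termB (A : fp_cat R) (k l : {linear (sval A : lmodType R) -> family_sum}) t :
  ev_term (k - l) t = ev_term k t - ev_term l t.
Proof.
apply/eqP; rewrite eq_sym subr_eq eq_sym; apply/eqP.
rewrite /ev_term -psh_resD; congr (psh_res F _ _).
apply: linear_ext => a; apply: etrans (lin_addE _ _ _) _.
by rewrite [X in X + _](linearB (dcoord t)) subrK.
Qed.

Lemma evB (A : fp_cat R) (k l : {linear (sval A : lmodType R) -> family_sum}) :
  ev (k - l) = ev k - ev l.
Proof.
have [s us sk] := ev_supp k; have [s' us' sl] := ev_supp l.
have us'' := undup_uniq (s ++ s').
have out t : t \notin undup (s ++ s') ->
    (forall a, dcoord t (k a) = 0) /\ (forall a, dcoord t (l a) = 0).
  rewrite mem_undup mem_cat negb_or => /andP[ts ts'].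
  by split=> a; [apply: sk | apply: sl].
rewrite !(ev_sum us''); first by rewrite -sumrB; apply: eq_bigr => t _; apply: ev_termB.
- by move=> a t /out[].
- by move=> a t /out[].
- by move=> a t /out[k0 l0]; rewrite lin_subE linearB k0 l0 subr0.
Qed.

Lemma ev_res (A B : fp_cat R) (h : {linear (sval A : lmodType R) -> (sval B : lmodType R)})
    (k : {linear (sval B : lmodType R) -> family_sum}) :
  psh_res F (h : Defs.hom A B) (ev k) = ev (A := A) (k \o h : {linear _ -> _}).
Proof.
have [s us sk] := ev_supp k.
rewrite (ev_sum us sk) (ev_sum (A := A) us) => [|a t ts]; last exact: sk.
rewrite raddf_sum; apply: eq_bigr => t _; rewrite /ev_term -psh_res_comp.
by congr (psh_res F _ _); apply: linear_ext.
Qed.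

Lemma ev_inj t : ev (A := C t) (dinj (C := fun t => sval (C t) : lmodType R) t) = u_ t.
Proof.
rewrite (ev_sum (s := [:: t])) // => [|a t']; last first.
  by rewrite inE eq_sym => /dcoord_inj_out->.
rewrite big_seq1 /ev_term -[RHS](@psh_res1 _ F); congr (psh_res F _ _).
by apply: linear_ext => a; rewrite /= dcoord_inj.
Qed.

End Evaluation.

(** [F] is presented as the cokernel of [(-, b)]. By Yoneda, [Y] has one summand for each element of
    [F] at a module [presented d], and the source of [b] has one summand for each map from such a
    module to [Y] that [e] kills. *)
Lemma presheaf_presentation : exists (T : choiceType) (C : T -> lmodType R) (Y : lmodType R)
    (b : {linear dsum C -> Y})
    (e : forall A : fp_cat R, {linear (sval A : lmodType R) -> Y} -> psh_val F A),
  [/\ forall t, finitely_presented (C t),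
      (forall A k l, e A (k - l) = e A k - e A l) /\ (forall A q, exists k, e A k = q),
      forall (A B : fp_cat R) (h : {linear (sval A : lmodType R) -> (sval B : lmodType R)}) k,
        psh_res F (h : Defs.hom A B) (e B k) = e A (k \o h : {linear _ -> _})
    & forall A k, e A k = 0 <->
        exists w : {linear (sval A : lmodType R) -> dsum C}, forall x, b (w x) = k x].
Proof.
pose T : choiceType := {classic {d : presentation & psh_val F (fp_presented_ob d)}}.
pose Y := family_sum (fun t : T => fp_presented_ob (projT1 t)).
pose e A (k : {linear (sval A : lmodType R) -> Y}) : psh_val F A :=
  ev (C := fun t : T => fp_presented_ob (projT1 t)) (fun t => projT2 t) k.
have eB A (k l : {linear (sval A : lmodType R) -> Y}) : e A (k - l) = e A k - e A l.
  exact: evB.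
have e_res (A B : fp_cat R) (h : {linear (sval A : lmodType R) -> (sval B : lmodType R)}) k :
    psh_res F (h : Defs.hom A B) (e B k) = e A (k \o h : {linear _ -> _}).
  exact: ev_res.
have e0 A : e A 0 = 0 by rewrite -[0 in LHS](subrr 0) eB subrr.
have e_fun A (k l : {linear (sval A : lmodType R) -> Y}) : k =1 l -> e A k = e A l.
  by move=> /linear_ext->.
pose T' : choiceType := {classic {d : presentation &
  {k : {linear (sval (fp_presented_ob d) : lmodType R) -> Y} | e (fp_presented_ob d) k = 0}}}.
pose C (t : T') : lmodType R := presented (projT1 t).
pose k_ (t : T') : {linear C t -> Y} := sval (projT2 t).
have k_0 (t : T') : e (fp_presented_ob (projT1 t)) (k_ t) = 0 by exact: svalP (projT2 t).
have [b bE] := dsum_elim k_.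
exists T', C, Y, b, e; split; [by move=> t; apply: fp_presented | split=> // A q | done | ].
  case: A q => A fA q; have [d [j [j' jK]]] := presentedP fA.
  pose A' : fp_cat R := exist _ A fA.
  pose t : T := existT _ d (psh_res F (j' : Defs.hom (fp_presented_ob d) A') q).
  pose i : {linear presented d -> Y} := dinj (C := fun t : T => presented (projT1 t)) t.
  have ei : e (fp_presented_ob d) i = psh_res F (j' : Defs.hom (fp_presented_ob d) A') q.
    exact: (ev_inj (C := fun t : T => fp_presented_ob (projT1 t)) (fun t => projT2 t) t).
  exists (i \o j); rewrite -(@e_res A' (fp_presented_ob d)) ei -psh_res_comp.
  rewrite -[RHS](@psh_res1 _ F); congr (psh_res F _ _); apply: linear_ext => x; exact: jK.
move=> [A fA] k; pose A' : fp_cat R := exist _ A fA; split=> [ek|[w wE]].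
  have [d [j [j' jK]]] := presentedP fA.
  have kj' : e (fp_presented_ob d) (k \o j' : {linear presented d -> Y}) = 0.
    by rewrite -(@e_res (fp_presented_ob d) A') ek raddf0.
  (* Composed with [j'], the map [k] becomes one of the indexing relations; its summand, entered
     through [j], gives back [k]. *)
  pose t : T' := existT _ d (exist _ (k \o j' : {linear presented d -> Y}) kj').
  exists (dinj (C := C) t \o j) => x; rewrite /= bE.
  by rewrite /k_ /= jK.
have [n [p psurj]] := fp_generated fA.
have [s us sw] := dsum_fg_supp w psurj.
have term t : e A' (k_ t \o (dcoord t \o w) : {linear A -> Y}) = 0.
  by rewrite -(@e_res A' (fp_presented_ob (projT1 t)) (dcoord t \o w)) k_0 raddf0.
have eD (f g : {linear A -> Y}) : e A' f = 0 -> e A' g = 0 -> e A' (f + g) = 0.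
  move=> f0 g0; rewrite -[g]opprK eB f0 -[- g]add0r eB e0 g0 !subr0.
  by [].
rewrite (@e_fun A' k (\sum_(t <- s) (k_ t \o (dcoord t \o w) : {linear A -> Y}))).
  by elim/big_ind: _.
move=> x; rewrite lin_sumE -wE {1}(dsum_fg_decomp us sw) lin_sumE linear_sum.
by apply: eq_bigr => t _; rewrite /= bE.
Qed.

End Presentation.

(** * Embeddings into free modules and density *)

Section Density.
Variable R : pzRingType.
Hypothesis flR : finite_length (R^o : lmodType R).
Hypothesis injR : injective_module (R^o : lmodType R).
Hypothesis injRc : injective_module ((R^c)^o : lmodType R^c).
Hypothesis artRc : artinian_module ((R^c)^o : lmodType R^c).

(* A proper left ideal has a nonzero right annihilator. *)
Lemma regular_cogenerator (M : lmodType R) (x : M) : x <> 0 ->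
  exists phi : {linear M -> R^o}, phi x <> 0.
Proof.
move=> x0.
have f_lin : linear (fun r : R^o => (r : R) *: x).
  by move=> c r s; rewrite scalerDl scalerA.
pose f := mklin f_lin; have fE (r : R) : f r = r *: x by [].
have [y [Ly y0]] : exists y, right_annihilator (fun r : R^o => f r = 0) y /\ y <> 0.
  apply: contrapT => noy; apply: x0; rewrite -[x]scale1r -fE.
  apply: (double_annihilator injRc artRc (submod_ker f)) => y Ly.
  by rewrite mul1r; apply: contrapT => y0; apply: noy; exists y.
(* Right multiplication by [y] kills the annihilator of [x], so it extends along [r -> r x] to a
   functional on [M] with value [y] at [x]. *)
have g_lin : linear (fun r : R^o => (r : R) * (y : R) : R^o).
  by move=> c r s; rewrite mulrDl -mulrA.
have [|h hE] := injective_module_ext (f := f) (g := mklin g_lin) injR; first exact: Ly.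
exists h; have := hE 1; rewrite fE scale1r => ->.
by rewrite mklinE mul1r.
Qed.

(** Take a map to a free module with minimal kernel. A nonzero element of the kernel is detected by
    a functional, and adjoining that functional as a further coordinate would shrink the kernel. *)
Lemma fp_embeds_in_free (C : lmodType R) : finitely_presented C ->
  exists n (i : {linear C -> 'rV[R]_n}), injective i.
Proof.
move=> fC.
pose Cl N := exists n (i : {linear C -> 'rV[R]_n}), N = fun x => i x = 0.
have [||_ [[n [i ->]] min_i]] := finite_length_min (Cl := Cl) (finite_length_fp flR fC).
- by move=> _ [n [i ->]]; apply: submod_ker.
- by exists (fun x => (\0 : {linear C -> 'rV[R]_0}) x = 0), 0%N, \0.
exists n, i; apply: linear_inj0 => x ix; apply: contrapT => x0.
have [phi phix] := regular_cogenerator x0.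
have c_lin : linear (fun r : R^o => const_mx r : 'rV[R]_1).
  by move=> c u v; apply/rowP => k; rewrite !mxE.
pose i' : {linear C -> 'rV[R]_(n + 1)} := row_mx_lin R n 1 \o pair_lin i (mklin c_lin \o phi).
have i'E z : i' z = row_mx (i z) (const_mx (phi z)) by [].
have i'0 z : i' z = 0 -> i z = 0 /\ phi z = 0.
  rewrite i'E => e; split; first by rewrite -[i z](row_mxKl _ (const_mx (phi z) : 'rV_1)) e linear0.
  have := row_mxKr (i z) (const_mx (phi z) : 'rV_1).
  by rewrite e => /rowP/(_ 0); rewrite !mxE => <-.
apply: phix; apply: (i'0 x _).2.
by apply: (min_i (fun z => i' z = 0)) ix => [|z /i'0[]]; [exists (n + 1)%N, i'|].
Qed.

Lemma theta_dense (F : ab_presheaf (fp_cat R)) : vanishing (@fp_projective R) F ->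
  exists f : S_cat R, isomorphic (theta f) F.
Proof.
move=> vF.
have [T [C [Y [b [e [fpC [eB e_surj] e_res e_eq0]]]]]] := presheaf_presentation F.
have n_ex t : exists n, exists i : {linear C t -> 'rV[R]_n}, injective i.
  exact: fp_embeds_in_free.
pose n_ t := sval (cid (n_ex t)); pose i_ t := sval (cid (svalP (cid (n_ex t)))).
have i_inj t : injective (i_ t) := svalP (cid (svalP (cid (n_ex t)))).
pose E := dsum (fun t => 'rV[R]_(n_ t) : lmodType R).
have [|i iE] := @dsum_intro R T (fun t => 'rV[R]_(n_ t) : lmodType R) (dsum C)
    (fun t => i_ t \o dcoord t).
  move=> x; have [s _ sx] := dsum_supp x; exists s => t /sx /= ->.
  exact: linear0.
have i_inj' : injective i.
  apply: linear_inj0 => x ix; apply: dsum_ext => t; apply: (i_inj t).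
  by rewrite -[LHS](iE x t) ix !linear0.
pose W : lmodType R := (Y * E)%type.
pose m : {linear dsum C -> W} := pair_lin b i.
have m_inj : injective m by move=> x y [_ /i_inj'].
pose f : S_cat R := exist _ (@Arrow (module_cat R) (dsum C) W m) ((monomorphismP m).2 m_inj).
exists f.
pose pr (A : fp_cat R) (h : {linear (sval A : lmodType R) -> W}) :
  {linear (sval A : lmodType R) -> Y} := fst_lin Y E \o h.
have e0 A : e A 0 = 0 by rewrite -[0 in LHS](subrr 0) eB subrr.
have eD A k l : e A (k + l) = e A k + e A l.
  by rewrite -[l in LHS]opprK -[- l]sub0r !eB e0 sub0r opprK.
(* The component in [E] does not affect the class, [E] being a direct sum of free modules, and on
   the component in [Y] the class is governed by [e]. *)
have key A (h : {linear (sval A : lmodType R) -> W}) :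
    theta_pi (f := f) h = 0 <-> e A (pr A h) = 0.
  split=> [/theta_pi_eq0_trace[t [u [trt hE]]]|/e_eq0[w wE]].
    have -> : pr A h = (b \o u : {linear _ -> _}) + pr A t.
      by apply: linear_ext => x; rewrite lin_addE /= hE.
    rewrite eD (_ : e A (b \o u : {linear _ -> _}) = 0) ?add0r; last by apply/e_eq0; exists u.
    (* [e] kills the first component of every trace element, because [F] vanishes on projectives. *)
    elim: trt {hE} => [|q l v {}t Qq _ IH].
      by rewrite (_ : pr A 0 = 0) //; apply: linear_ext.
    have -> : pr A (psh_res (hom_presheaf W) l v + t) =
        (pr q v \o (l : {linear (sval A : lmodType R) -> (sval q : lmodType R)}) : {linear _ -> _})
        + pr A t by apply: linear_ext.
    by rewrite eD IH addr0 -(e_res A q l (pr q v)) (vF q Qq (e q _)) raddf0.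
  (* Subtracting [m w] from [h] clears the component in [Y]; [h2] is what remains in [E]. *)
  have [h2 h2E] : exists h2 : {linear (sval A : lmodType R) -> E},
      forall x, h2 x = (h x).2 - i (w x).
    by exists ((snd_lin Y E \o h : {linear _ -> _}) - (i \o w : {linear _ -> _})).
  apply/theta_pi_eq0_trace.
  exists ((pair_lin \0 idfun : {linear E -> W}) \o h2 : {linear (sval A : lmodType R) -> W}), w.
  split; first by apply: trace_dsum => t; [exact: projective_row | exact: fp_row].
  move=> x; rewrite [LHS]surjective_pairing -[(h x).1]/(pr A h x) -wE /= h2E.
  by congr pair; rewrite /= ?addr0 // addrC subrK.
apply: (@isomorphic_of_relation (fp_cat R) (theta f) F (fun A q v =>
  exists h : {linear (sval A : lmodType R) -> W}, theta_pi (f := f) h = q /\ e A (pr A h) = v)).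
- by move=> A q; have [h hq] := theta_pi_surj q; exists (e A (pr A h)), h.
- move=> A v; have [k kv] := e_surj A v.
  exists (theta_pi (f := f) (pair_lin k \0 : {linear _ -> W})), (pair_lin k \0).
  by split=> //; rewrite -kv; congr (e A _); apply: linear_ext.
- move=> A q v q' v' [h [<- <-]] [h' [<- <-]]; exists (h - h'); split; first exact: theta_piB.
  by rewrite -eB; congr (e A _); apply: linear_ext.
- by move=> A v [h [/key h0 <-]].
- by move=> A q [h [<- /key]].
move=> A B l q v [h [<- <-]]; exists (h \o (l : {linear (sval A : lmodType R) -> _})).
split; first exact/esym/theta_pi_res.
by rewrite e_res; congr (e A _); apply: linear_ext.
Qed.

End Density.

(** * Passage to the stable functor category and conclusion *)

Lemma full_subcat_isomorphic (C : precat) (Q : C -> Prop) (x y : full_subcat Q) :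
  isomorphic (sval x) (sval y) -> isomorphic x y.
Proof. by case=> a [b [ba ab]]; exists a, b. Qed.

Lemma full_subcat_zero_object (C : precat) (Q : C -> Prop) (x : full_subcat Q) :
  zero_object (sval x) -> zero_object x.
Proof. by case=> x0 x0'; split=> y h; [apply: x0 | apply: x0']. Qed.

Lemma zero_presheaf (A : precat) (F : ab_presheaf A) :
  (forall x (u : psh_val F x), u = 0) -> zero_object F.
Proof.
move=> F0; split=> G h; apply: psh_app_ext => x u.
  by rewrite (F0 x u) !raddf0.
exact: etrans (F0 x _) (esym (F0 x _)).
Qed.

#[local] Strategy opaque [quot_functor quot_lift Defs.image_sub trace_sub].

Theorem theorem6p4 (R : pzRingType) :
  quasi_Frobenius R -> finite_representation_type R ->
  full (Theta R) /\ dense (Theta R) /\ objective (Theta R).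
Proof.
case=> artR artRc injR injRc frt.
have flR := finite_length_regular injRc artRc artR.
have [L lenL] := uniform_length flR frt.
split; [|split].
- move=> f g a; have [s e] := theta_full flR lenL injR (a : nattrans (theta f) (theta g)).
  by exists s; exact: e.
- case=> F vF; have [f fF] := theta_dense flR injR injRc artRc vF.
  by exists f; apply: full_subcat_isomorphic.
move=> f g s s0.
have s0' C q : psh_app (theta_map s) C q = 0.
  exact (congr1 (fun t : @Defs.hom (stable_presheaf R) (Theta R f) (Theta R g) =>
    psh_app (t : nattrans (theta f) (theta g)) C q) s0).
have [k [a [b [k0 sab]]]] := theta_objective flR lenL s0'.
exists k, a, b; split; last exact: sab.
by apply: full_subcat_zero_object; apply: (zero_presheaf (F := theta k)).
Qed.
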